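(* Let $p>2$ be a prime, $\mathbf{F}$ a field of characteristic $p$, $M=(c_{ij})\in\mathbf{F}^{2\times3}$, and let $V_M$ be the associated three-dimensional representation of $G=(\mathbf{Z}/p)^3=\langle e_1,e_2,e_3\rangle$, so that $G$ acts on $\mathbf{F}[V_M]=\mathbf{F}[x,y,z]$ by algebra automorphisms with $x\cdot e_i=x$, $y\cdot e_i=y+c_{1i}x$, $z\cdot e_i=z+2c_{1i}y+(c_{1i}^2+c_{2i})x$ for $i=1,2,3$. Let $\overline\gamma_{ijk}$, $f$, $h$, $N_G(z)$ be as defined in the context. If $\overline\gamma_{123}=0$, $\overline\gamma_{124}\neq0$ and $\overline\gamma_{135}\neq0$, then $\{x,f,h,N_G(z)\}$ is a SAGBI basis for $\mathbf{F}[V_M]^G$ with respect to the graded reverse lexicographic order with $x<y<z$. Furthermore, there is a single relation among the generators, constructed by subducting $f^{p^2+p+2}-h^p$.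
   Context: Let $\delta=y^2-xz$. Let $\overline\gamma_{ijk}\in\mathbf{F}$ be the $3\times3$ minor, on rows $i<j<k$, of the matrix whose rows $1,\ldots,5$ are $(c_{11},c_{12},c_{13})$, $(c_{21},c_{22},c_{23})$, $(c_{11}^p,c_{12}^p,c_{13}^p)$, $(c_{21}^p,c_{22}^p,c_{23}^p)$, $(c_{11}^{p^2},c_{12}^{p^2},c_{13}^{p^2})$. For a polynomial $g$, $N_G(g)$ is the product of the (distinct) elements of the $G$-orbit of $g$. Under the hypotheses $\overline\gamma_{123}=0$, $\overline\gamma_{124}\neq0$, $\overline\gamma_{135}\neq0$, put $c=\overline\gamma_{134}/\overline\gamma_{124}$ (which is non-zero) and define the invariants $$f=y^p+\frac{\overline\gamma_{134}}{\overline\gamma_{124}}\delta x^{p-2}+\frac{\overline\gamma_{234}}{\overline\gamma_{124}}yx^{p-1},$$ $$\widetilde h=N_G(y)-f^{p^2}+c^{p^2}f^{2p}x^{p^3-2p^2}-2c^{p^2+p}f^{p+2}x^{p^3-p^2-2p},\qquad h=\frac{\widetilde h}{-4c^{p^2+p+1}x^{p^3-p^2-p-2}};$$ $h$ is a polynomial with lead term $y^{p^2+p+2}$. A subset $\mathcal{B}$ of a subalgebra $A$ of a polynomial ring is a SAGBI basis for $A$ if the lead monomials of the elements of $\mathcal{B}$ generate, as an algebra, the lead term algebra of $A$ (the algebra spanned by the lead monomials of nonzero elements of $A$); then $\mathcal{B}$ generates $A$. To subduct a polynomial $F$ over $\mathcal{B}$ is to repeatedly subtract from it scalar multiples of products of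 elements of $\mathcal{B}$ having the same lead term as the current polynomial; for a SAGBI basis, every $F\in A$ subducts to $0$. If $F$ is a polynomial expression in elements of $\mathcal{B}$, its subduction to $0$ yields an identity $F-\sum_I c_I\,b^I=0$ with products $b^I$ of elements of $\mathcal{B}$: this is the relation constructed by subducting $F$. ''A single relation'' means that the ideal of all algebraic relations among the listed generators is generated by that one relation. *)

(* Defs.v *)
From HB Require Import structures.
From mathcomp Require Import all_boot all_order all_algebra.
From mathcomp Require Import mpoly ring.

Set Implicit Arguments.
Unset Strict Implicit.
Unset Printing Implicit Defensive.

Import GRing.Theory.
Local Open Scope ring_scope.

(** * Graded reverse lexicographic order and lead monomials *)

(* The variables are ordered 'X_0 < 'X_1 < ... < 'X_(n-1): between monomials of
   equal degree, at the smallest variable whose exponents differ, the monomial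
   with the larger exponent is the smaller one. *)
Definition grevlex_lt (n : nat) (m1 m2 : 'X_{1..n}) : bool :=
  (mdeg m1 < mdeg m2)%N ||
  ((mdeg m1 == mdeg m2) &&
   [exists i : 'I_n, (m2 i < m1 i)%N &&
      [forall j : 'I_n, (j < i)%N ==> (m1 j == m2 j)]]).

Definition grevlex_max (n : nat) (m1 m2 : 'X_{1..n}) : 'X_{1..n} :=
  if grevlex_lt m1 m2 then m2 else m1.

(* The unit monomial is the least one, so it is a neutral starting value;
   it is also the (irrelevant) value at g = 0. *)
Definition lead_mon (n : nat) (R : nzRingType) (g : {mpoly R[n]}) : 'X_{1..n} :=
  \big[@grevlex_max n/0%MM]_(m <- msupp g) m.

Definition lead_cf (n : nat) (R : nzRingType) (g : {mpoly R[n]}) : R :=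
  g@_(lead_mon g).

(** * SAGBI bases and subduction *)

Definition lead_monomials (n : nat) (R : nzRingType)
    (S : {mpoly R[n]} -> Prop) (u : {mpoly R[n]}) : Prop :=
  exists g, [/\ S g, g != 0 & u = 'X_[lead_mon g]].

Inductive lin_span (n : nat) (R : nzRingType) (S : {mpoly R[n]} -> Prop) :
    {mpoly R[n]} -> Prop :=
| lin_span0 : lin_span S 0
| lin_spanD c u v : S u -> lin_span S v -> lin_span S (c *: u + v).

Inductive alg_gen (n : nat) (R : nzRingType) (S : {mpoly R[n]} -> Prop) :
    {mpoly R[n]} -> Prop :=
| alg_gen_in u : S u -> alg_gen S u
| alg_genC c : alg_gen S c%:MP
| alg_genD u v : alg_gen S u -> alg_gen S v -> alg_gen S (u + v)
| alg_genM u v : alg_gen S u -> alg_gen S v -> alg_gen S (u * v).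

Definition sagbi_basis (n : nat) (R : nzRingType)
    (A B : {mpoly R[n]} -> Prop) : Prop :=
  (forall b, B b -> A b) /\
  (forall u, alg_gen (lead_monomials B) u <-> lin_span (lead_monomials A) u).

(* [subducts b g Q]: some sequence of subduction steps over the family [b]
   takes [g] to 0.  The polynomial [Q], in one variable per member of [b],
   records what was subtracted: it is the sum of the c_I 'X_[I] over the steps
   subtracting c_I b^I, where b^I is written ['X_[I] \mPo b]. *)
Inductive subducts (n k : nat) (R : comNzRingType)
    (b : k.-tuple {mpoly R[n]}) : {mpoly R[n]} -> {mpoly R[k]} -> Prop :=
| subducts0 : subducts b 0 0
| subductsS g c (I : 'X_{1..k}) Q :
    g != 0 ->
    lead_mon g = lead_mon ('X_[I] \mPo b) ->
    lead_cf g = c * lead_cf ('X_[I] \mPo b) ->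
    subducts b (g - c *: ('X_[I] \mPo b)) Q ->
    subducts b g (c *: 'X_[I] + Q).

Lemma subductsE (n k : nat) (R : comNzRingType) (b : k.-tuple {mpoly R[n]}) g Q :
  subducts b g Q -> g = Q \mPo b.
Proof.
elim=> [|{}g c I {}Q _ _ _ _ IH]; first by rewrite comp_mpoly0.
by rewrite comp_mpolyD comp_mpolyZ -IH addrC subrK.
Qed.

(** * The representation V_M of (Z/p)^3 *)

Section Representation.

Variables (p : nat) (F : fieldType) (M : 'M[F]_(2, 3)).

Definition vx : {mpoly F[3]} := 'X_(@Ordinal 3 0 isT).
Definition vy : {mpoly F[3]} := 'X_(@Ordinal 3 1 isT).
Definition vz : {mpoly F[3]} := 'X_(@Ordinal 3 2 isT).

Definition c1 (i : 'I_3) : F := M ord0 i.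
Definition c2 (i : 'I_3) : F := M ord_max i.

Definition act_gen (i : 'I_3) (g : {mpoly F[3]}) : {mpoly F[3]} :=
  g \mPo [tuple vx;
                vy + c1 i *: vx;
                vz + (2%:R * c1 i) *: vy + (c1 i ^+ 2 + c2 i) *: vx].

(* The group (Z/p)^3 is written additively; the standard basis vector
   [delta_mx 0 i] plays the role of the generator e_i. *)
Definition act (a : 'rV['F_p]_3) (g : {mpoly F[3]}) : {mpoly F[3]} :=
  iter (a 0 (@Ordinal 3 2 isT)) (act_gen (@Ordinal 3 2 isT))
    (iter (a 0 (@Ordinal 3 1 isT)) (act_gen (@Ordinal 3 1 isT))
      (iter (a 0 (@Ordinal 3 0 isT)) (act_gen (@Ordinal 3 0 isT)) g)).

(* The action in closed form, which shows that it is a group action. *)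
Definition shear (a b : F) (g : {mpoly F[3]}) : {mpoly F[3]} :=
  g \mPo [tuple vx; vy + a *: vx; vz + (2%:R * a) *: vy + (a ^+ 2 + b) *: vx].

Lemma shearD a b a' b' g : shear a' b' (shear a b g) = shear (a + a') (b + b') g.
Proof.
rewrite /shear [g \mPo _]comp_mpolyEX [RHS]comp_mpolyEX raddf_sum /=.
apply/eq_bigr => m _; rewrite comp_mpolyZ !comp_mpolyX rmorph_prod /=.
congr (_ *: _); apply/eq_bigr => i _; rewrite rmorphXn /=; congr (_ ^+ _).
case: i => [[|[|[|i]]] Hi] //; rewrite !(tnth_nth 0) /=
  ?comp_mpolyD ?comp_mpolyZ !comp_mpolyXU //= -!mul_mpolyC
  ?(rmorphD, rmorphM, rmorphXn, rmorph_nat) /=; ring.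
Qed.

Lemma shear0 g : shear 0 0 g = g.
Proof.
rewrite /shear -[RHS]comp_mpoly_id; congr (_ \mPo _).
apply: eq_from_tnth => i; rewrite tnth_mktuple.
by case: i => [[|[|[|i]]] Hi] //; rewrite !(tnth_nth 0) /=
  ?mulr0 ?expr0n ?addr0 ?scale0r ?addr0; congr 'X_[U_(_)]; apply: val_inj.
Qed.

Lemma iter_act_gen n i g :
  iter n (act_gen i) g = shear (n%:R * c1 i) (n%:R * c2 i) g.
Proof.
elim: n => [|n IH]; first by rewrite /= !mul0r shear0.
by rewrite iterS IH -[act_gen i _]/(shear _ _ _) shearD !mulr_natl -!mulrSr.
Qed.

Lemma actE a g :
  act a g = shear (\sum_i (a 0 i : nat)%:R * c1 i) (\sum_i (a 0 i : nat)%:R * c2 i) g.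
Proof.
have sum3 (E : 'I_3 -> F) : \sum_i E i =
    E (@Ordinal 3 0 isT) + E (@Ordinal 3 1 isT) + E (@Ordinal 3 2 isT).
  rewrite !big_ord_recl big_ord0 addr0 addrA.
  by congr (E _ + E _ + E _); apply: val_inj.
by rewrite /act !iter_act_gen !shearD !addrA !sum3.
Qed.

Lemma act_delta i g : act (delta_mx 0 i) g = act_gen i g.
Proof.
rewrite actE -[RHS]/(shear _ _ _).
have sum_delta (c : 'I_3 -> F) :
    \sum_j ((delta_mx 0 i : 'rV['F_p]_3) 0 j : nat)%:R * c j = c i.
  rewrite (bigD1 i) // big1 => [|j /negbTE ji]; rewrite mxE ?eqxx ?ji ?mul0r //.
  have -> : ((true && true)%:R : 'F_p) = 1%N :> nat by [].
  by rewrite [LHS]addr0 mul1r.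
by rewrite !sum_delta.
Qed.

Lemma actD (a b : 'rV['F_p]_3) g :
  prime p -> p \in [pchar F] -> act (a + b) g = act b (act a g).
Proof.
move=> p_pr charF.
have natD i : (nat_of_ord ((a + b) 0 i))%:R =
    (a 0 i : nat)%:R + (b 0 i : nat)%:R :> F.
  have -> : nat_of_ord ((a + b) 0 i) = ((a 0%R i + b 0%R i) %% p)%N.
    by rewrite mxE; exact: (congr1 (modn (a 0%R i + b 0%R i)%N) (Fp_cast p_pr)).
  by rewrite (GRing.natr_mod_pchar charF) natrD.
have sumD (c : 'I_3 -> F) : \sum_i (nat_of_ord ((a + b) 0 i))%:R * c i =
    \sum_i (a 0 i : nat)%:R * c i + \sum_i (b 0 i : nat)%:R * c i.
  by rewrite -big_split /=; apply/eq_bigr => i _; rewrite natD mulrDl.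
by rewrite !actE shearD !sumD.
Qed.

Definition is_invariant (g : {mpoly F[3]}) : Prop := forall a, act a g = g.

Definition orbit_prod (g : {mpoly F[3]}) : {mpoly F[3]} :=
  \prod_(u <- undup (codom (fun a => act a g))) u.

(** * The invariants f and h *)

(* Rows are numbered from 1: rows 1, 3, 5 are c_1j, c_1j^p, c_1j^(p^2) and rows
   2, 4 are c_2j, c_2j^p. *)
Definition frob_row (r : nat) (j : 'I_3) : F :=
  (if odd r then c1 j else c2 j) ^+ (p ^ (r.-1)./2).

Definition gammabar (i j k : nat) : F :=
  \det (\matrix_(r < 3, s < 3) frob_row (nth 0%N [:: i; j; k] r) s).

Definition cbar : F := gammabar 1 3 4 / gammabar 1 2 4.

Definition delta_inv : {mpoly F[3]} := vy ^+ 2 - vx * vz.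

Definition inv_f : {mpoly F[3]} :=
  vy ^+ p
  + (gammabar 1 3 4 / gammabar 1 2 4) *: (delta_inv * vx ^+ (p - 2))
  + (gammabar 2 3 4 / gammabar 1 2 4) *: (vy * vx ^+ (p - 1)).

Definition htilde : {mpoly F[3]} :=
  orbit_prod vy
  - inv_f ^+ (p ^ 2)
  + (cbar ^+ (p ^ 2)) *: (inv_f ^+ (2 * p) * vx ^+ (p ^ 3 - 2 * p ^ 2))
  - (2%:R * cbar ^+ (p ^ 2 + p)) *:
      (inv_f ^+ (p + 2) * vx ^+ (p ^ 3 - p ^ 2 - 2 * p)).

(* h is the quotient of htilde by -4 c^(p^2+p+1) x^(p^3-p^2-p-2). *)
Definition is_inv_h (h : {mpoly F[3]}) : Prop :=
  htilde =
    (- 4%:R * cbar ^+ (p ^ 2 + p + 1)) *: (vx ^+ (p ^ 3 - p ^ 2 - p - 2) * h).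

End Representation.

(* Main.v *)
From HB Require Import structures.
Require Import Defs.
From mathcomp Require Import all_boot all_order all_algebra.
From mathcomp Require Import fraction.
From mathcomp Require Import mpoly ring zify.

(* Put c = cbar, m = p^2+p+2.  The lead monomials of x, f, h, N_G(z) are x, y^p,
   y^m, z^(p^3).  Since m = 2 mod p, two products of generators with h-degree
   less than p have distinct lead monomials, so such products ("low" monomials)
   are linearly independent, and remain so modulo x once those divisible by x
   are set aside.  Hence a low expression divisible by x is x times a low one.

   After inverting x, the coordinates Y = y/x and w = f/x^p generate, and G acts
   by the translations Y -> Y + alpha, alpha ranging over the F_p-span of the
   c_1i.  So the invariants become polynomials in prod (Y + alpha), that is, in
   N_G(y), hence in h; and N_G(z), of degree p^4 in Y, becomes a polynomial of
   degree p in h with constant lead coefficient up to a power of x.  Dividing by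
   x as above gives x^(p^2+2p) N_G(z) = a h^p + (low), a <> 0.  This is a monic
   relation for h over the other generators, so every invariant times a power
   of x has a low expression, and dividing by x again, so does every invariant.
   Its lead monomial is then that of a low monomial, which is the SAGBI
   property.  A subduction Q of f^m - h^p only involves products whose lead
   monomial is smaller than y^(p m), which forces them to be low; so
   f^m - h^p - Q is also monic of degree p in h, and division by it shows that
   it generates the ideal of relations. *)

Set Implicit Arguments.
Unset Strict Implicit.
Unset Printing Implicit Defensive.

Import GRing.Theory.
Local Open Scope ring_scope.

(** * The monomial order *)

Section Grevlex.

Variable n : nat.
Implicit Types m : 'X_{1..n}.

Lemma grevlex_ltP m1 m2 :
  reflect ((mdeg m1 < mdeg m2)%N \/ mdeg m1 = mdeg m2 /\
    exists i : 'I_n, (m2 i < m1 i)%N /\ forall j : 'I_n, (j < i)%N -> m1 j = m2 j)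
  (grevlex_lt m1 m2).
Proof.
apply: (iffP orP) => -[]; first by left.
- case/andP=> /eqP -> /existsP[i /andP[lt_i /forallP eq_j]]; right; split=> //.
  by exists i; split=> // j lt_ji; apply/eqP/(implyP (eq_j j)).
- by left.
- case=> -> [i [lt_i eq_j]]; right; rewrite eqxx; apply/existsP; exists i.
  by rewrite lt_i; apply/forallP=> j; apply/implyP=> /eq_j ->.
Qed.

Lemma grevlex_ltxx m : grevlex_lt m m = false.
Proof. by apply/grevlex_ltP => -[|[_ [i []]]]; rewrite ltnn. Qed.

Lemma grevlex_trans m2 m1 m3 :
  grevlex_lt m1 m2 -> grevlex_lt m2 m3 -> grevlex_lt m1 m3.
Proof.
case/grevlex_ltP=> [lt12|[e12 [i [lti eqi]]]] /grevlex_ltP[lt23|[e23 [j [ltj eqj]]]];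
  apply/grevlex_ltP; try by left; lia.
right; split; first by lia.
case: (ltngtP i j) => [ij|ji|/val_inj ij].
- exists i; rewrite -(eqj _ ij); split=> // k ki.
  by rewrite eqi // eqj // (ltn_trans ki).
- exists j; rewrite (eqi _ ji); split=> // k kj.
  by rewrite eqi ?eqj // (ltn_trans kj).
- exists i; split; first by rewrite -ij in ltj; apply: ltn_trans lti.
  by move=> k ki; rewrite eqi // eqj // -ij.
Qed.

Lemma grevlex_total m1 m2 : m1 != m2 -> grevlex_lt m1 m2 || grevlex_lt m2 m1.
Proof.
move=> ne; case: (ltngtP (mdeg m1) (mdeg m2)) => [lt12|lt21|e12].
- by apply/orP; left; apply/grevlex_ltP; left.
- by apply/orP; right; apply/grevlex_ltP; left.
have [i0 ne0] : exists i, m1 i != m2 i.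
  apply/existsP; apply: contraNT ne; rewrite negb_exists => /forallP eqm.
  by apply/eqP/mnmP => i; apply/eqP; rewrite -[_ == _]negbK.
case: (@arg_minnP _ i0 (fun i => m1 i != m2 i) val) => // i nei min_i.
have eqj (j : 'I_n) : (j < i)%N -> m1 j = m2 j.
  by move=> ji; apply/eqP; apply: contraTT ji => /min_i; rewrite -leqNgt.
apply/orP; case: (ltngtP (m1 i) (m2 i)) nei => // lti _.
- by right; apply/grevlex_ltP; right; split=> //; exists i; split=> // j /eqj.
- by left; apply/grevlex_ltP; right; split=> //; exists i; split=> // j /eqj.
Qed.

Lemma grevlex_ltD2l m m1 m2 :
  grevlex_lt m1 m2 -> grevlex_lt (m + m1)%MM (m + m2)%MM.
Proof.
case/grevlex_ltP=> [lt12|[e12 [i [lti eqi]]]]; apply/grevlex_ltP; rewrite !mdegD.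
  by left; rewrite ltn_add2l.
right; split; first by rewrite e12.
exists i; rewrite !mnmDE ltn_add2l; split=> // j ji.
by rewrite !mnmDE eqi.
Qed.

Lemma grevlex_ltD m1 m2 m1' m2' :
  m1 = m2 \/ grevlex_lt m1 m2 -> grevlex_lt m1' m2' ->
  grevlex_lt (m1 + m1')%MM (m2 + m2')%MM.
Proof.
move=> le lt'; have lt2 := grevlex_ltD2l m2 lt'.
case: le => [->//|lt]; apply: grevlex_trans lt2.
by rewrite ![(_ + m1')%MM]addmC; apply: grevlex_ltD2l.
Qed.

Lemma grevlex_lt_mdeg m1 m2 : grevlex_lt m1 m2 -> (mdeg m1 <= mdeg m2)%N.
Proof. by case/grevlex_ltP=> [/ltnW|[->]]. Qed.


Lemma grevlex_0lt m : m != 0%MM -> grevlex_lt 0%MM m.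
Proof.
by rewrite -mdeg_eq0 -lt0n => lt0; apply/grevlex_ltP; left; rewrite mdeg0.
Qed.

Lemma grevlex_asym m1 m2 : grevlex_lt m1 m2 -> ~~ grevlex_lt m2 m1.
Proof. by move=> lt12; apply/negP=> /(grevlex_trans lt12); rewrite grevlex_ltxx. Qed.

(** The map [f] lets this serve both for the terms of one polynomial and for the lead monomials of a
    family of products. *)
Lemma grevlex_maxP (T : eqType) (f : T -> 'X_{1..n}) (s : seq T) : s != [::] ->
  exists2 t, t \in s & forall u, u \in s -> f u = f t \/ grevlex_lt (f u) (f t).
Proof.
elim: s => // u s IHs _; have [->|/IHs[t ts max_t]] := eqVneq s [::].
  by exists u; rewrite ?mem_head // => v; rewrite inE => /eqP->; left.
have [eq_ut|ne_ut] := eqVneq (f u) (f t).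
  exists t; first by rewrite inE ts orbT.
  by move=> v; rewrite inE => /predU1P[->|/max_t //]; left.
case/orP: (grevlex_total ne_ut) => [lt_ut|lt_tu].
  exists t; first by rewrite inE ts orbT.
  by move=> v; rewrite inE => /predU1P[->|/max_t //]; right.
exists u; first exact: mem_head.
move=> v; rewrite inE => /predU1P[->|/max_t]; first by left.
by case=> [->|lt_vt]; right=> //; apply: grevlex_trans lt_tu.
Qed.

End Grevlex.

(** * Lead monomials and lead coefficients, over a ring and then over a domain *)

Section LeadMon.

Variables (n : nat) (R : nzRingType).
Implicit Types g : {mpoly R[n]}.

Lemma lead_monE g m : m \in msupp g ->
  (forall m', m' \in msupp g -> m' = m \/ grevlex_lt m' m) -> lead_mon g = m.
Proof.
move=> gm max_m.
(* The induction runs over sublists of the support, where [m] may not have been met yet; the fold is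
   then below [m] or still at its starting value. *)
suff H s : {subset s <= msupp g} ->
    let M := \big[@grevlex_max n/0%MM]_(k <- s) k in
    (M = m \/ grevlex_lt M m \/ M = 0%MM) /\ (m \in s -> M = m).
  by have [_ /(_ gm)] := H _ (fun x => id).
elim: s => [|k s IHs] sub /=; first by rewrite big_nil; split; auto.
rewrite big_cons; have /IHs[le_s eq_s] : {subset s <= msupp g}.
  by move=> x xs; apply: sub; rewrite inE xs orbT.
have le_k := max_m k (sub k (mem_head _ _)).
set M := \big[_/_]_(_ <- s) _ in le_s eq_s *; split.
  by rewrite /grevlex_max; case: ifP => // _; tauto.
rewrite inE => /predU1P[<-|/eq_s ->]; rewrite /grevlex_max; last first.
  by case: le_k => [->|->//]; rewrite grevlex_ltxx.
case: ifP => // lt_kM; case: le_s => [//|].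
case=> [lt_Mm|M0]; first by rewrite (negbTE (grevlex_asym _)) in lt_kM.
have [k0|/grevlex_0lt] := eqVneq m 0%MM; first by rewrite M0 k0.
by rewrite -M0 => /grevlex_asym; rewrite lt_kM.
Qed.

Lemma lead_monP g : g != 0 -> lead_mon g \in msupp g /\
  forall m, m \in msupp g -> m = lead_mon g \/ grevlex_lt m (lead_mon g).
Proof.
rewrite -msupp_eq0 => /(grevlex_maxP id)[m gm max_m].
by rewrite (lead_monE gm max_m).
Qed.

Lemma lead_mon_msupp g : g != 0 -> lead_mon g \in msupp g.
Proof. by case/lead_monP. Qed.

Lemma msupp_le_lead_mon g m : m \in msupp g ->
  m = lead_mon g \/ grevlex_lt m (lead_mon g).
Proof.
move=> gm; have [|_ max_g] := @lead_monP g; last exact: max_g.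
by apply: contraTneq gm => ->; rewrite msupp0.
Qed.

Lemma lead_cf_eq0 g : (lead_cf g == 0) = (g == 0).
Proof.
apply/idP/eqP => [|->]; last by rewrite /lead_cf mcoeff0.
by apply: contraTeq => /lead_mon_msupp; rewrite mcoeff_msupp.
Qed.

Lemma mcoeff_lt_lead_mon g m : grevlex_lt (lead_mon g) m -> g@_m = 0.
Proof.
move=> lt_gm; apply/memN_msupp_eq0/negP => /msupp_le_lead_mon[e|lt_mg].
  by rewrite -e grevlex_ltxx in lt_gm.
by rewrite (negbTE (grevlex_asym lt_gm)) in lt_mg.
Qed.

Lemma lead_mon_bound g m0 : g != 0 -> g@_m0 = 0 ->
  (forall m, m \in msupp g -> m = m0 \/ grevlex_lt m m0) -> grevlex_lt (lead_mon g) m0.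
Proof.
move=> /lead_mon_msupp gl g0 /(_ _ gl)[e|//].
by move: gl; rewrite mcoeff_msupp e g0 eqxx.
Qed.

Lemma lead_monX m : lead_mon ('X_[m] : {mpoly R[n]}) = m.
Proof.
apply: lead_monE => [|m']; first by rewrite msuppX mem_head.
by rewrite msuppX inE => /eqP; left.
Qed.

Lemma lead_cfX m : lead_cf ('X_[m] : {mpoly R[n]}) = 1.
Proof. by rewrite /lead_cf lead_monX mcoeffX eqxx. Qed.

Lemma lead_mon1 : lead_mon (1 : {mpoly R[n]}) = 0%MM.
Proof. by rewrite -mpolyX0 lead_monX. Qed.

Lemma lead_cf1 : lead_cf (1 : {mpoly R[n]}) = 1.
Proof. by rewrite -mpolyX0 lead_cfX. Qed.

End LeadMon.

Section LeadMonDomain.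

Variables (n : nat) (R : idomainType).
Implicit Types g : {mpoly R[n]}.

(** Any other pair of monomials from the two supports has a strictly smaller product, so only the
    pair of lead monomials contributes. *)
Lemma mcoeffM_lead g1 g2 :
  (g1 * g2)@_(lead_mon g1 + lead_mon g2) = lead_cf g1 * lead_cf g2.
Proof.
have [->|nz1] := eqVneq g1 0; first by rewrite /lead_cf mul0r !mcoeff0 mul0r.
have [->|nz2] := eqVneq g2 0; first by rewrite /lead_cf mulr0 !mcoeff0 mulr0.
rewrite mpolyME (bigD1_seq (lead_mon g1, lead_mon g2)) /=; first last.
- by rewrite allpairs_uniq => // -[? ?] [].
- by rewrite allpairs_f// !lead_mon_msupp.
rewrite mcoeffD mcoeffZ mcoeffX eqxx mulr1.
rewrite big_seq_cond raddf_sum /= big1 ?addr0 // => m /andP[].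
case/allpairsP=> -[m1 m2] /= [/msupp_le_lead_mon le1 /msupp_le_lead_mon le2 ->] ne.
rewrite mcoeffZ mcoeffX; case: eqP => [e|]; last by rewrite mulr0.
suff : grevlex_lt (m1 + m2)%MM (lead_mon g1 + lead_mon g2)%MM by rewrite e grevlex_ltxx.
case: le2 => [e2|lt2]; last exact: grevlex_ltD.
case: le1 => [e1|lt1]; first by rewrite e1 e2 eqxx in ne.
by rewrite ![(_ + m2)%MM]addmC ![(_ + lead_mon g2)%MM]addmC; apply: grevlex_ltD; auto.
Qed.

Lemma lead_monM g1 g2 : g1 != 0 -> g2 != 0 ->
  lead_mon (g1 * g2) = (lead_mon g1 + lead_mon g2)%MM.
Proof.
move=> nz1 nz2; apply: lead_monE.
  by rewrite mcoeff_msupp mcoeffM_lead mulf_neq0 ?lead_cf_eq0.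
move=> m /msuppM_le /allpairsP[[m1 m2] /= [/msupp_le_lead_mon le1 /msupp_le_lead_mon le2 ->]].
case: le2 => [e2|lt2]; last by right; apply: grevlex_ltD.
case: le1 => [e1|lt1]; first by left; rewrite e1 e2.
by right; rewrite ![(_ + m2)%MM]addmC ![(_ + lead_mon g2)%MM]addmC; apply: grevlex_ltD; auto.
Qed.

Lemma lead_cfM g1 g2 : lead_cf (g1 * g2) = lead_cf g1 * lead_cf g2.
Proof.
have [->|nz1] := eqVneq g1 0; first by rewrite /lead_cf mul0r !mcoeff0 mul0r.
have [->|nz2] := eqVneq g2 0; first by rewrite /lead_cf mulr0 !mcoeff0 mulr0.
by rewrite {1}/lead_cf lead_monM // mcoeffM_lead.
Qed.

Lemma lead_mon_prod (I : Type) (s : seq I) (P : pred I) (G : I -> {mpoly R[n]}) :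
  (forall i, P i -> G i != 0) ->
  lead_mon (\prod_(i <- s | P i) G i) = (\sum_(i <- s | P i) lead_mon (G i))%MM.
Proof.
move=> nzG; elim: s => [|i s IHs]; first by rewrite !big_nil lead_mon1.
rewrite !big_cons; case: ifP => // Pi; rewrite lead_monM ?IHs ?nzG //.
by elim/big_ind: _ => [|g1 g2 nz1 nz2|j /nzG //]; rewrite ?oner_neq0 ?mulf_neq0.
Qed.

Lemma lead_cfXn g k : lead_cf (g ^+ k) = lead_cf g ^+ k.
Proof. by elim: k => [|k IHk]; rewrite ?expr0 ?lead_cf1 // !exprS lead_cfM IHk. Qed.

Lemma lead_monXn g k : g != 0 -> lead_mon (g ^+ k) = (lead_mon g *+ k)%MM.
Proof.
move=> nzg; elim: k => [|k IHk]; first by rewrite expr0 lead_mon1 mulm0n.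
by rewrite exprS lead_monM ?expf_neq0 // IHk mulmS.
Qed.

End LeadMonDomain.

(** * Subduction *)

Section Subduction.

Variables (n k : nat) (F : fieldType) (b : k.-tuple {mpoly F[n]}).
Hypothesis nzb : forall i, tnth b i != 0.

Lemma comp_mpolyX_neq0 I : 'X_[I] \mPo b != 0.
Proof.
rewrite comp_mpolyX; apply/prodf_neq0 => i _; exact/expf_neq0/nzb.
Qed.

Lemma lead_mon_compX I :
  lead_mon ('X_[I] \mPo b) = (\sum_i lead_mon (tnth b i) *+ I i)%MM.
Proof.
rewrite comp_mpolyX lead_mon_prod => [|i _]; last exact/expf_neq0/nzb.
by apply: eq_bigr => i _; rewrite lead_monXn.
Qed.

(** Products with distinct lead monomials cannot cancel at the top: the largest of these monomials
    occurs in only one of the products. *)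
Lemma lead_mon_comp (T : {mpoly F[k]}) : T != 0 ->
  {in msupp T &, injective (fun I => lead_mon ('X_[I] \mPo b))} ->
  T \mPo b != 0 /\
  exists2 I, I \in msupp T & lead_mon (T \mPo b) = lead_mon ('X_[I] \mPo b).
Proof.
move=> nzT injT; have nzs : msupp T != [::] by rewrite msupp_eq0.
have [I IT maxI] := grevlex_maxP (fun I => lead_mon ('X_[I] \mPo b)) nzs.
set m := lead_mon _ in maxI.
have lt_J J : J \in msupp T -> J != I -> grevlex_lt (lead_mon ('X_[J] \mPo b)) m.
  by move=> JT; case: (maxI J JT) => // /(injT _ _ JT IT) ->; rewrite eqxx.
have mT : (T \mPo b)@_m != 0.
  rewrite comp_mpolyEX raddf_sum (bigD1_seq I) ?msupp_uniq //=.
  rewrite big_seq_cond big1 => [|J /andP[JT ne]]; last first.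
    by rewrite mcoeffZ (mcoeff_lt_lead_mon (lt_J _ JT ne)) mulr0.
  rewrite addr0 mcoeffZ mulf_neq0 -?mcoeff_msupp //.
  by rewrite mcoeff_msupp -/(lead_cf _) lead_cf_eq0 comp_mpolyX_neq0.
have supT : m \in msupp (T \mPo b) by rewrite mcoeff_msupp.
split; first by apply: contraTneq supT => ->; rewrite msupp0.
exists I => //; apply: lead_monE => [//|m'].
rewrite comp_mpolyEX mcoeff_msupp raddf_sum => nz.
have /hasP[J JT] : has (fun J => (T@_J *: ('X_[J] \mPo b))@_m' != 0) (msupp T).
  apply: contraNT nz => /hasPn z; rewrite big_seq big1 // => J /z.
  by rewrite negbK => /eqP.
rewrite mcoeffZ mulf_eq0 negb_or -[X in _ && X]mcoeff_msupp => /andP[_].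
case/msupp_le_lead_mon=> [->|lt]; first exact: maxI.
right; case: (maxI J JT) => [e|lt2]; last exact: grevlex_trans lt lt2.
by move: lt; rewrite e.
Qed.

Lemma lead_mon_sub_lt (g1 g2 : {mpoly F[n]}) : lead_mon g1 = lead_mon g2 ->
  lead_cf g1 = lead_cf g2 -> g1 - g2 != 0 -> grevlex_lt (lead_mon (g1 - g2)) (lead_mon g1).
Proof.
move=> em ec nz; apply: lead_mon_bound => //.
  by rewrite mcoeffB {2}em -/(lead_cf _) -/(lead_cf g2) ec subrr.
move=> m /msuppB_le; rewrite mem_cat => /orP[] /msupp_le_lead_mon //.
by rewrite em.
Qed.

Lemma lead_mon_subduct_step g c I : g != 0 ->
  lead_mon g = lead_mon ('X_[I] \mPo b) ->
  lead_cf g = c * lead_cf ('X_[I] \mPo b) ->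
  g - c *: ('X_[I] \mPo b) != 0 ->
  grevlex_lt (lead_mon (g - c *: ('X_[I] \mPo b))) (lead_mon g).
Proof.
move=> nzg em ec; have nzc : c != 0.
  by apply: contra_neq nzg => c0; apply/eqP; rewrite -lead_cf_eq0 ec c0 mul0r.
have cE : c%:MP_[n] = c *: 'X_[0] by rewrite mpolyX0 -mul_mpolyC mulr1.
have nzC : c%:MP_[n] != 0 by rewrite mpolyC_eq0.
apply: lead_mon_sub_lt; rewrite -mul_mpolyC ?lead_monM ?lead_cfM ?comp_mpolyX_neq0 //.
  rewrite -em; suff -> : lead_mon c%:MP_[n] = 0%MM by rewrite add0m.
  apply: lead_monE => [|m]; rewrite msuppC (negbTE nzc) ?mem_head //.
  by rewrite inE => /eqP; left.
rewrite ec; congr (_ * _); rewrite /lead_cf.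
suff -> : lead_mon c%:MP_[n] = 0%MM by rewrite mcoeffC eqxx mulr1.
apply: lead_monE => [|m]; rewrite msuppC (negbTE nzc) ?mem_head //.
by rewrite inE => /eqP; left.
Qed.

(** Monomials below [m] have degree at most [mdeg m], so this finite count misses none of them. It
    reduces induction along the order to induction on naturals. *)
Definition grevlex_rank (m : 'X_{1..n}) :=
  #|[pred m' : 'X_{1..n < (mdeg m).+1} | grevlex_lt m' m]|.

Lemma grevlex_rank_lt m1 m2 :
  grevlex_lt m1 m2 -> (grevlex_rank m1 < grevlex_rank m2)%N.
Proof.
move=> lt12; have le12 := grevlex_lt_mdeg lt12.
have bnd (m' : 'X_{1..n < (mdeg m1).+1}) : (mdeg m' < (mdeg m2).+1)%N.
  by rewrite (leq_trans (bmdeg m')).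
pose w (m' : 'X_{1..n < (mdeg m1).+1}) := BMultinom (bnd m').
have inj_w : injective w.
  by move=> u v /(congr1 val) /= e; apply: val_inj.
have m1b : (mdeg m1 < (mdeg m2).+1)%N by [].
rewrite /grevlex_rank -(card_image inj_w); apply: proper_card.
apply/properP; split.
  apply/subsetP => v /imageP[u]; rewrite !inE => lt ->.
  exact: grevlex_trans lt lt12.
exists (BMultinom m1b); rewrite ?inE //.
apply/imageP => -[u]; rewrite inE => lt /(congr1 val) /= e.
by rewrite -e grevlex_ltxx in lt.
Qed.

Lemma grevlex_ind (P : 'X_{1..n} -> Prop) :
  (forall m, (forall m', grevlex_lt m' m -> P m') -> P m) -> forall m, P m.
Proof.
move=> step m; have [N] := ubnP (grevlex_rank m).
elim: N m => // N IHN m ltN; apply: step => m' /grevlex_rank_lt lt.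
by apply: IHN; apply: leq_trans lt _; rewrite -ltnS.
Qed.

(** A step stays in [A], so another one is possible until [0] is reached, and it strictly lowers the
    lead monomial; well-foundedness ends the process. *)
Lemma subducts_exists (A : {mpoly F[n]} -> Prop) :
  (forall g c I, A g -> A (g - c *: ('X_[I] \mPo b))) ->
  (forall g, A g -> g != 0 -> exists I, lead_mon g = lead_mon ('X_[I] \mPo b)) ->
  forall g, A g -> exists Q, subducts b g Q.
Proof.
move=> subA leadA g; have [m] : exists m, lead_mon g = m by exists (lead_mon g).
elim/grevlex_ind: m g => m IHm g gm Ag.
have [->|nzg] := eqVneq g 0; first by exists 0; left.
have [I gI] := leadA g Ag nzg.
have nzI : lead_cf ('X_[I] \mPo b) != 0 by rewrite lead_cf_eq0 comp_mpolyX_neq0.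
pose c := lead_cf g / lead_cf ('X_[I] \mPo b).
have ec : lead_cf g = c * lead_cf ('X_[I] \mPo b) by rewrite divfK.
have AgI := subA g c I Ag; have [g0|nz] := eqVneq (g - c *: ('X_[I] \mPo b)) 0.
  by exists (c *: 'X_[I] + 0); apply: subductsS => //; rewrite g0; left.
have := lead_mon_subduct_step nzg gI ec nz; rewrite gm => /IHm/(_ _ erefl AgI)[Q sQ].
by exists (c *: 'X_[I] + Q); apply: subductsS.
Qed.

(** The products subtracted have strictly decreasing lead monomials, starting from that of [g]. *)
Lemma subducts_lead_mon g Q I : subducts b g Q -> I \in msupp Q ->
  lead_mon ('X_[I] \mPo b) = lead_mon g \/
  grevlex_lt (lead_mon ('X_[I] \mPo b)) (lead_mon g).
Proof.
elim=> [|{}g c J {}Q nzg em ec sQ IHQ]; first by rewrite msupp0.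
move=> /msuppD_le; rewrite mem_cat => /orP[/msuppZ_le|IQ].
  by rewrite msuppX inE => /eqP->; left.
(* A zero remainder admits only the empty subduction, which leaves no monomial in [Q]. *)
have nz : g - c *: ('X_[J] \mPo b) != 0.
  by apply: contraTneq IQ => z; case: sQ z => [_|? ? ? ? + _ _ _ e]; rewrite ?msupp0 ?e ?eqxx.
have lt := lead_mon_subduct_step nzg em ec nz.
by right; case: (IHQ IQ) => [->|/grevlex_trans]; last exact.
Qed.

End Subduction.

Notation ord3 k := (@Ordinal 3 k isT).
Notation ord4 k := (@Ordinal 4 k isT).

Lemma big_ord3 (T : Type) (idx : T) (op : Monoid.law idx) (E : 'I_3 -> T) :
  \big[op/idx]_i E i = op (E (ord3 0)) (op (E (ord3 1)) (E (ord3 2))).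
Proof.
rewrite !big_ord_recl big_ord0 Monoid.mulm1.
by congr (op (E _) (op (E _) (E _))); apply: val_inj.
Qed.

Lemma big_ord4 (T : Type) (idx : T) (op : Monoid.law idx) (E : 'I_4 -> T) :
  \big[op/idx]_i E i =
  op (E (ord4 0)) (op (E (ord4 1)) (op (E (ord4 2)) (E (ord4 3)))).
Proof.
rewrite !big_ord_recl big_ord0 Monoid.mulm1.
by congr (op (E _) (op (E _) (op (E _) (E _)))); apply: val_inj.
Qed.

(** * Degree in one variable and division by a monic polynomial *)

Section DegreeBound.

Variables (n : nat) (R : comNzRingType) (i : 'I_n).
Implicit Types T : {mpoly R[n]}.

Definition deg_le d T := forall I, I \in msupp T -> (I i <= d)%N.

Lemma deg_leW d e T : (d <= e)%N -> deg_le d T -> deg_le e T.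
Proof. by move=> de dT I /dT /leq_trans; apply. Qed.

Lemma deg_leC d c : deg_le d c%:MP.
Proof. by move=> I; rewrite msuppC; case: eqP => // _; rewrite inE => /eqP ->; rewrite mnm0E. Qed.

Lemma deg_le0 d : deg_le d 0.
Proof. exact: deg_leC. Qed.

Lemma deg_leX d (I : 'X_{1..n}) : (I i <= d)%N -> deg_le d 'X_[I].
Proof. by move=> Id J; rewrite msuppX inE => /eqP->. Qed.

Lemma deg_leD d T1 T2 : deg_le d T1 -> deg_le d T2 -> deg_le d (T1 + T2).
Proof. by move=> d1 d2 I /msuppD_le; rewrite mem_cat => /orP[/d1|/d2]. Qed.

Lemma deg_leZ d c T : deg_le d T -> deg_le d (c *: T).
Proof. by move=> dT I /msuppZ_le/dT. Qed.

Lemma deg_leB d T1 T2 : deg_le d T1 -> deg_le d T2 -> deg_le d (T1 - T2).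
Proof. by move=> d1 d2; rewrite -scaleN1r; apply/deg_leD/deg_leZ. Qed.

Lemma deg_leM d e T1 T2 : deg_le d T1 -> deg_le e T2 -> deg_le (d + e) (T1 * T2).
Proof.
move=> d1 d2 I /msuppM_le/allpairsP[[I1 I2] /= [/d1 le1 /d2 le2 ->]].
by rewrite mnmDE leq_add.
Qed.

Lemma deg_leXn d T k : deg_le d T -> deg_le (d * k) (T ^+ k).
Proof.
move=> dT; elim: k => [|k IHk]; first by rewrite expr0; apply: deg_leC.
by rewrite exprS mulnS; apply: deg_leM.
Qed.

Lemma deg_le_exists T : exists d, deg_le d T.
Proof.
exists (\max_(I <- msupp T) I i)%N => I IT.
by rewrite (big_rem I) //= leq_maxl.
Qed.

(** Trading ['X_i ^+ q.+1] for [W] lowers the degree in ['X_i], as [W] has degree at most [q]. The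
    induction is on the excess of the degree over [q]. *)
Lemma deg_le_monic_division (q : nat) (W P : {mpoly R[n]}) :
  deg_le q W -> exists S T, deg_le q T /\ P = S * ('X_i ^+ q.+1 - W) + T.
Proof.
move=> lowW; have [N0 dP] := deg_le_exists P.
have {dP} : deg_le (q + N0) P by apply: deg_leW dP; apply: leq_addl.
elim: N0 P => [|N IHN] P dP; first by exists 0, P; rewrite mul0r add0r; rewrite addn0 in dP.
suff [S [T [dT ->]]] : exists S T, deg_le (q + N) T /\ P = S * ('X_i ^+ q.+1 - W) + T.
  have [S' [T' [dT' ->]]] := IHN _ dT.
  by exists (S + S'), T'; split=> //; rewrite mulrDl addrA.
have red I : I \in msupp P ->
    exists S T, deg_le (q + N) T /\ 'X_[I] = S * ('X_i ^+ q.+1 - W) + T.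
  move=> /dP dI; case: (leqP (I i) (q + N)) => [le|gt].
    by exists 0, 'X_[I]; rewrite mul0r add0r; split=> //; apply: deg_leX.
  have eI : I = (I - U_(i) *+ q.+1 + U_(i) *+ q.+1)%MM.
    rewrite submK //; apply/mnm_lepP => j; rewrite mulmnE mnm1E.
    by case: eqP => [<-|//]; rewrite mul1n; lia.
  (* At most [N] copies of the variable are left and [W] adds at most [q]. *)
  exists 'X_[I - U_(i) *+ q.+1], ('X_[I - U_(i) *+ q.+1] * W); split.
    apply: (@deg_leW (N + q)); first by lia.
    apply: deg_leM => //; apply: deg_leX.
    by rewrite mnmBE mulmnE mnm1E eqxx mul1n; lia.
  by rewrite {1}eI mpolyXD -mpolyXn -mulrDr subrK.
rewrite [P]mpolyE big_seq.
elim/big_rec: _ => [|I T IT [S1 [T1 [dT1 ->]]]].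
  by exists 0, 0; rewrite mul0r addr0; split=> //; apply: deg_le0.
have [S2 [T2 [dT2 ->]]] := red I IT.
exists (P@_I *: S2 + S1), (P@_I *: T2 + T1); split; first exact/deg_leD/dT1/deg_leZ.
by rewrite -!mul_mpolyC; ring.
Qed.

End DegreeBound.

(** * Expressions of low degree in the third of four generators *)

Section Hypersurface.

Variables (F : fieldType) (p q : nat) (B : 4.-tuple {mpoly F[3]}).
Hypothesis p_odd : odd p.
Let e := (p ^ 2 + p + 2)%N.
Hypothesis B0 : tnth B (ord4 0) = vx F.
Hypothesis nzB : forall i, tnth B i != 0.
Hypothesis lmB1 : lead_mon (tnth B (ord4 1)) = (U_(ord3 1) *+ p)%MM.
Hypothesis lmB2 : lead_mon (tnth B (ord4 2)) = (U_(ord3 1) *+ e)%MM.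
Hypothesis lmB3 : lead_mon (tnth B (ord4 3)) = (U_(ord3 2) *+ q)%MM.
Hypothesis q_gt0 : (0 < q)%N.

Lemma lead_mon_compXE (I : 'X_{1..4}) : let m := lead_mon ('X_[I] \mPo B) in
  [/\ m (ord3 0) = I (ord4 0),
      m (ord3 1) = (p * I (ord4 1) + e * I (ord4 2))%N
    & m (ord3 2) = (q * I (ord4 3))%N].
Proof.
rewrite /= lead_mon_compX // big_ord4 /= lmB1 lmB2 lmB3 B0 lead_monX.
by split; rewrite !mnmDE !mulmnE !mnm1E /= !(mul0n, mul1n) ?addn0 ?add0n.
Qed.

(* [e] is [2] modulo the odd number [p], so the exponent [p a + e b] of the
   second variable determines [b] as long as [b < p]. *)
Lemma lead_mon_compX_inj (I J : 'X_{1..4}) : (I (ord4 2) <= p.-1)%N -> (J (ord4 2) <= p.-1)%N ->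
  lead_mon ('X_[I] \mPo B) = lead_mon ('X_[J] \mPo B) -> I = J.
Proof.
have p_gt0 : (0 < p)%N by case: p p_odd.
move=> ltI ltJ eqm; have [I0 I1 I2] := lead_mon_compXE I.
have [J0 J1 J2] := lead_mon_compXE J; rewrite eqm in I0 I1 I2.
have e0 : I (ord4 0) = J (ord4 0) by rewrite -I0 -J0.
have e3 : I (ord4 3) = J (ord4 3).
  by apply/eqP; rewrite -(eqn_pmul2l q_gt0) -I2 -J2.
have e12 : (p * I (ord4 1) + e * I (ord4 2) = p * J (ord4 1) + e * J (ord4 2))%N.
  by rewrite -I1 -J1.
have e2 : I (ord4 2) = J (ord4 2).
  have cop : coprime p e.
    by rewrite /coprime /e (_ : p ^ 2 + p + 2 = p.+1 * p + 2)%N ?gcdnMDl -?/(coprime p 2) ?coprimen2 //; lia.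
  have le x y u v : (v <= p.-1)%N -> (p * x + e * v = p * y + e * u)%N -> (v <= u)%N.
    move=> lt_v exy; rewrite leqNgt; apply/negP => lt_uv.
    have : (p %| e * (v - u))%N.
      by apply/dvdnP; exists (y - x)%N; rewrite mulnBr mulnBl; lia.
    by rewrite Gauss_dvdr // => /dvdn_leq; lia.
  by apply/eqP; rewrite eqn_leq (le _ _ _ _ ltI e12) (le _ _ _ _ ltJ (esym e12)).
have e1 : I (ord4 1) = J (ord4 1).
  by apply/eqP; rewrite -(eqn_pmul2l p_gt0); apply/eqP; move: e12; rewrite e2; lia.
apply/mnmP => -[[|[|[|[|i]]]] Hi] //.
- by rewrite (bool_irrelevance Hi isT).
- by rewrite (bool_irrelevance Hi isT).
- by rewrite (bool_irrelevance Hi isT).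
- by rewrite (bool_irrelevance Hi isT).
Qed.

Let low (T : {mpoly F[4]}) := deg_le (ord4 2) p.-1 T.

Lemma lead_mon_comp_low T : low T -> T != 0 -> T \mPo B != 0 /\
  exists2 I, I \in msupp T & lead_mon (T \mPo B) = lead_mon ('X_[I] \mPo B).
Proof.
move=> lowT nzT; apply: lead_mon_comp => // I J IT JT /=.
by apply: lead_mon_compX_inj; apply: lowT.
Qed.

(** Low products have distinct lead monomials, hence are linearly independent. *)
Lemma comp_low_eq0 T : low T -> T \mPo B = 0 -> T = 0.
Proof.
by move=> lowT T0; apply: contra_eq T0 => /(lead_mon_comp_low lowT)[].
Qed.

(* No lead monomial of the part of [T] without the first variable is divisible
   by [vx], so that part vanishes when [vx] divides [T \mPo B]. *)
Lemma comp_low_divx T g : low T -> vx F * g = T \mPo B ->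
  exists2 T', low T' & g = T' \mPo B.
Proof.
move=> lowT gT.
pose T0 := \sum_(I <- msupp T | I (ord4 0) == 0%N) T@_I *: 'X_[I].
pose T1 := \sum_(I <- msupp T | I (ord4 0) != 0%N) T@_I *: 'X_[I - U_(ord4 0)].
have TE : T = T0 + 'X_(ord4 0) * T1.
  rewrite {1}[T]mpolyE (bigID (fun I : 'X_{1..4} => I (ord4 0) == 0%N)) /=; congr (_ + _).
  rewrite mulr_sumr; apply: eq_bigr => I nz0.
  by rewrite -scalerAr -mpolyXD addmC submK // lep1mP.
have compX0 : 'X_(ord4 0) \mPo B = vx F by rewrite comp_mpolyXU -B0 (tnth_nth 0).
have supT0 (I : 'X_{1..4}) : I \in msupp T0 -> I \in msupp T /\ I (ord4 0) = 0%N.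
  move/msupp_sum_le/flattenP => -[s /mapP[J]].
  rewrite mem_filter => /andP[/eqP J0 JT] -> /msuppZ_le.
  by rewrite msuppX inE => /eqP->.
have T00 : T0 = 0.
  have [//|nzT0] := eqVneq T0 0.
  have lowT0 : low T0 by move=> I /supT0[/lowT].
  have [nz [I /supT0[_ I0] lm]] := lead_mon_comp_low lowT0 nzT0.
  have T0B : T0 \mPo B = vx F * (g - (T1 \mPo B)).
    by rewrite mulrBr gT TE rmorphD rmorphM /= compX0 addrK.
  have := lead_mon_compXE I => -[+ _ _]; rewrite -lm I0 T0B lead_monM.
  - by rewrite lead_monX mnmDE mnm1E eqxx.
  - by apply: contraNneq nz => z; rewrite T0B z mul0r.
  - by apply: contraNneq nz => z; rewrite T0B z mulr0.
exists T1.
  move=> I /msupp_sum_le/flattenP => -[s /mapP[J]].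
  rewrite mem_filter => /andP[_ JT] -> /msuppZ_le.
  by rewrite msuppX inE => /eqP->; rewrite mnmBE mnm1E subn0 lowT.
have nzx : vx F != 0 by rewrite -B0.
by apply: (mulfI nzx); rewrite gT TE T00 add0r rmorphM /= compX0.
Qed.

Lemma comp_low_divxn k T g : low T -> vx F ^+ k * g = T \mPo B ->
  exists2 T', low T' & g = T' \mPo B.
Proof.
elim: k T g => [|k IHk] T g lowT; first by rewrite mul1r; exists T.
rewrite exprS -mulrA => /(comp_low_divx lowT)[T' lowT' /(IHk _ _ lowT')[T'' lowT'' ->]].
by exists T''.
Qed.

(** Division by the monic relation leaves a low remainder, and the multiple of the relation vanishes
    on [B]. *)
Lemma comp_low_of_relation W P : low W ->
  ('X_(ord4 2) ^+ p - W) \mPo B = 0 -> exists2 T, low T & P \mPo B = T \mPo B.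
Proof.
have p_gt0 : (0 < p)%N by case: p p_odd.
move=> lowW; rewrite -{1}(prednK p_gt0) => WB.
have [S [T [lowT ->]]] := deg_le_monic_division P lowW.
by exists T => //; rewrite rmorphD rmorphM /= WB mulr0 add0r.
Qed.

(** The remainder of [P] modulo the monic relation is low and vanishes on [B], so it is zero by
    independence of the low products. *)
Lemma kernel_of_relation W P : low W -> ('X_(ord4 2) ^+ p - W) \mPo B = 0 ->
  P \mPo B = 0 <-> exists S, P = S * ('X_(ord4 2) ^+ p - W).
Proof.
have p_gt0 : (0 < p)%N by case: p p_odd.
move=> lowW WB; split=> [PB|[S ->]]; last by rewrite rmorphM /= WB mulr0.
have [S [T [lowT PE]]] := deg_le_monic_division P lowW.
rewrite prednK // in PE; exists S; rewrite PE (@comp_low_eq0 T) ?addr0 //.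
by move: PB; rewrite PE rmorphD rmorphM /= WB mulr0 add0r.
Qed.

(** If the third generator had exponent at least [p] in a subtracted product, [y] would have
    exponent at least [p * e] in its lead monomial. The order bounds the total degree by [p * e], so
    that monomial would be [y^(p e)] itself, which is excluded. *)
Lemma subducts_low g Q : subducts B g Q ->
  grevlex_lt (lead_mon g) (U_(ord3 1) *+ (p * e))%MM -> low Q.
Proof.
move=> sQ lt_g I /(subducts_lead_mon nzB sQ) le_I.
have {le_I lt_g} lt_I : grevlex_lt (lead_mon ('X_[I] \mPo B)) (U_(ord3 1) *+ (p * e))%MM.
  by case: le_I => [->//|/grevlex_trans]; apply.
rewrite -ltnS prednK; last by case: p p_odd.
rewrite ltnNge; apply/negP => ge_p.
have le_pe : (p * e <= e * I (ord4 2))%N by rewrite mulnC leq_mul2l ge_p orbT.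
have [I0 I1 I2] := lead_mon_compXE I.
have := grevlex_lt_mdeg lt_I.
rewrite mdegMn mdeg1 mul1n mdegE big_ord3 /= => le_deg.
suff : lead_mon ('X_[I] \mPo B) = (U_(ord3 1) *+ (p * e))%MM.
  by move=> eqI; rewrite eqI grevlex_ltxx in lt_I.
apply/mnmP => -[[|[|[|j]]] Hj] //; rewrite (bool_irrelevance Hj isT) mulmnE mnm1E /=.
- by rewrite mul0n; lia.
- by rewrite mul1n; lia.
- by rewrite mul0n; lia.
Qed.

End Hypersurface.

(** * A lead monomial criterion for SAGBI bases *)

Section Sagbi.

Variables (n : nat) (F : fieldType).

Lemma lin_span_add (S : {mpoly F[n]} -> Prop) u v :
  lin_span S u -> lin_span S v -> lin_span S (u + v).
Proof.
move=> Su Sv; elim: Su => [|c w u' Sw _ IH]; first by rewrite add0r.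
by rewrite -addrA; apply: lin_spanD.
Qed.

Lemma lin_span_in (S : {mpoly F[n]} -> Prop) u : S u -> lin_span S u.
Proof. by move=> Su; rewrite -[u]addr0 -[u]scale1r; apply/lin_spanD/lin_span0. Qed.

Lemma lin_spanZ (S : {mpoly F[n]} -> Prop) c u : lin_span S u -> lin_span S (c *: u).
Proof.
elim=> [|d w u' Sw _ IH]; first by rewrite scaler0; left.
by rewrite scalerDr scalerA; apply: lin_spanD.
Qed.

Lemma lin_span_mul (S : {mpoly F[n]} -> Prop) u v :
  (forall u v, S u -> S v -> S (u * v)) ->
  lin_span S u -> lin_span S v -> lin_span S (u * v).
Proof.
move=> mulS Su Sv; elim: Su => [|c w u' Sw _ IH]; first by rewrite mul0r; left.
rewrite mulrDl; apply: lin_span_add => //; rewrite -scalerAl; apply: lin_spanZ.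
elim: Sv => [|d w' v' Sw' _ IHv]; first by rewrite mulr0; left.
by rewrite mulrDr -scalerAr; apply: lin_spanD => //; apply: mulS.
Qed.

Lemma alg_genXn (S : {mpoly F[n]} -> Prop) u k : alg_gen S u -> alg_gen S (u ^+ k).
Proof.
move=> Su; elim: k => [|k IHk]; first by rewrite expr0 -mpolyC1; apply: alg_genC.
by rewrite exprS; apply: alg_genM.
Qed.

(** Lead monomials of [A] are closed under products because [A] is, which gives one inclusion. For
    the other, the lead monomial of [b^I] is the corresponding product of lead monomials of the
    [b_i]. *)
Lemma sagbi_basis_of_lead_mon (k : nat) (b : k.-tuple {mpoly F[n]})
    (A : {mpoly F[n]} -> Prop) :
  (forall i, tnth b i != 0) -> A 1 -> (forall u v, A u -> A v -> A (u * v)) ->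
  (forall i, A (tnth b i)) ->
  (forall g, A g -> g != 0 -> exists I, lead_mon g = lead_mon ('X_[I] \mPo b)) ->
  sagbi_basis A (fun u => u \in b).
Proof.
move=> nzb A1 mulA Ab leadA.
have Ab' u : u \in b -> A u by case/tnthP=> i ->.
have mulLM u v : lead_monomials A u -> lead_monomials A v -> lead_monomials A (u * v).
  case=> g1 [A1' nz1 ->] [g2 [A2 nz2 ->]]; exists (g1 * g2).
  by split; [apply: mulA | rewrite mulf_neq0 | rewrite lead_monM // mpolyXD].
split=> // u; split.
  elim=> {u} [u [g [bg nzg ->]]|c|u v _ IHu _ IHv|u v _ IHu _ IHv].
  - by apply: lin_span_in; exists g; split=> //; apply: Ab'.
  - rewrite -[c%:MP]mulr1 mul_mpolyC; apply/lin_spanZ/lin_span_in.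
    by exists 1; split=> //; rewrite ?oner_neq0 // lead_mon1 mpolyX0.
  - exact: lin_span_add.
  - exact: lin_span_mul.
elim=> {u} [|c u v [g [Ag nzg ->]] _ IHv]; first by rewrite -mpolyC0; apply: alg_genC.
rewrite -mul_mpolyC; apply: alg_genD => //; apply: alg_genM; first exact: alg_genC.
have [I ->] := leadA g Ag nzg; rewrite lead_mon_compX //.
elim/big_rec: _ => [|i m _ IHm]; first by rewrite mpolyX0 -mpolyC1; apply: alg_genC.
rewrite mpolyXD -mpolyXn; apply: alg_genM => //; apply/alg_genXn/alg_gen_in.
by exists (tnth b i); split; rewrite ?mem_tnth.
Qed.

End Sagbi.

(** * The action and its invariants *)

Lemma det_matrix33 (R : comNzRingType) (E : 'I_3 -> 'I_3 -> R) :
  \det (\matrix_(r, s) E r s) =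
    E (ord3 0) (ord3 0) * (E (ord3 1) (ord3 1) * E (ord3 2) (ord3 2)
                           - E (ord3 1) (ord3 2) * E (ord3 2) (ord3 1))
  - E (ord3 0) (ord3 1) * (E (ord3 1) (ord3 0) * E (ord3 2) (ord3 2)
                           - E (ord3 1) (ord3 2) * E (ord3 2) (ord3 0))
  + E (ord3 0) (ord3 2) * (E (ord3 1) (ord3 0) * E (ord3 2) (ord3 1)
                           - E (ord3 1) (ord3 1) * E (ord3 2) (ord3 0)).
Proof.
(* Indices pass through natural numbers, so that the ordinals produced in different ways by the
   expansions become identical terms for [ring]. *)
pose e i j := E (inord i) (inord j).
have eE i j : E i j = e i j by rewrite /e !inord_val.
rewrite (expand_det_row _ ord0) !big_ord_recl big_ord0 /cofactor.
rewrite !(expand_det_row _ ord0) !big_ord_recl !big_ord0 /cofactor !det_mx11 !mxE !eE /=.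
rewrite /bump /=; ring.
Qed.

Section Action.

Variables (p : nat) (F : fieldType) (M : 'M[F]_(2, 3)).
Hypothesis p_prime : prime p.
Hypothesis charF : p \in [pchar F].
Let G := 'rV['F_p]_3.

(** The homomorphism from the group to [F] with value [c i] at [e_i]; characteristic [p] makes it
    additive in spite of the choice of representatives. *)
Definition lin (c : 'I_3 -> F) (a : G) := \sum_i (a 0 i : nat)%:R * c i.

Lemma linD c a b : lin c (a + b) = lin c a + lin c b.
Proof.
rewrite /lin -big_split; apply: eq_bigr => i _ /=; rewrite -mulrDl -natrD.
rewrite -(GRing.natr_mod_pchar charF (_ + _)) mxE; congr (_%:R * _).
exact: (congr1 (modn (a 0%R i + b 0%R i)%N) (Fp_cast p_prime)).
Qed.

Lemma linZ k c a : lin (fun i => k * c i) a = k * lin c a.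
Proof. by rewrite /lin mulr_sumr; apply: eq_bigr => i _; rewrite mulrCA. Qed.

Lemma lin_plus c d a : lin (fun i => c i + d i) a = lin c a + lin d a.
Proof. by rewrite /lin -big_split; apply: eq_bigr => i _; rewrite mulrDr. Qed.

Lemma frobD (R : comNzRingType) k (u v : R) : p \in [pchar R] ->
  (u + v) ^+ (p ^ k) = u ^+ (p ^ k) + v ^+ (p ^ k).
Proof.
move=> charR; elim: k => [|k IHk]; first by rewrite expn0 !expr1.
by rewrite expnSr !exprM IHk -!(pFrobenius_autE charR) rmorphD.
Qed.

(** Frobenius is additive and fixes the coefficients, which lie in the prime field. *)
Lemma lin_frob k c a : lin c a ^+ (p ^ k) = lin (fun i => c i ^+ (p ^ k)) a.
Proof.
rewrite /lin; elim/big_rec2: _ => [|i x y _ <-]; first by rewrite expr0n expn_eq0; case: (p) p_prime.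
rewrite frobD // exprMn; congr (_ * _ + _).
elim: k => [|k IHk]; first by rewrite expn0 expr1.
by rewrite expnSr exprM IHk -(pFrobenius_autE charF) rmorph_nat.
Qed.

Let alpha := lin (c1 M).
Let beta := lin (c2 M).

Lemma act_shear a g : act M a g = shear (alpha a) (beta a) g.
Proof. exact: actE. Qed.

Lemma shear_vx (a b : F) : shear a b (vx F) = vx F.
Proof. by rewrite /shear comp_mpolyXU. Qed.

Lemma shear_vy (a b : F) : shear a b (vy F) = vy F + a *: vx F.
Proof. by rewrite /shear comp_mpolyXU. Qed.

Lemma shear_vz (a b : F) :
  shear a b (vz F) = vz F + (2%:R * a) *: vy F + (a ^+ 2 + b) *: vx F.
Proof. by rewrite /shear comp_mpolyXU. Qed.

Lemma invariantP g :
  is_invariant p M g <-> forall a : G, shear (alpha a) (beta a) g = g.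
Proof. by split=> inv a; [rewrite -act_shear | rewrite act_shear]. Qed.

Lemma invariant_vx : is_invariant p M (vx F).
Proof. by apply/invariantP => a; rewrite shear_vx. Qed.

Lemma invariant1 : is_invariant p M 1.
Proof. by apply/invariantP => a; rewrite /shear rmorph1. Qed.

Lemma invariantM g h : is_invariant p M g -> is_invariant p M h -> is_invariant p M (g * h).
Proof.
move=> /invariantP ig /invariantP ih; apply/invariantP => a.
by rewrite {2}(esym (ig a)) {2}(esym (ih a)) /shear rmorphM.
Qed.

Lemma invariantD g h : is_invariant p M g -> is_invariant p M h -> is_invariant p M (g + h).
Proof.
move=> /invariantP ig /invariantP ih; apply/invariantP => a.
by rewrite {2}(esym (ig a)) {2}(esym (ih a)) /shear rmorphD.
Qed.

Lemma invariantZ c g : is_invariant p M g -> is_invariant p M (c *: g).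
Proof.
move=> /invariantP ig; apply/invariantP => a.
by rewrite {2}(esym (ig a)) /shear comp_mpolyZ.
Qed.

Lemma invariantB g h : is_invariant p M g -> is_invariant p M h -> is_invariant p M (g - h).
Proof. by move=> ig ih; rewrite -scaleN1r; apply/invariantD/invariantZ. Qed.

Lemma invariantXn g k : is_invariant p M g -> is_invariant p M (g ^+ k).
Proof.
move=> ig; elim: k => [|k IHk]; first by rewrite expr0; apply: invariant1.
by rewrite exprS; apply: invariantM.
Qed.

Lemma gammabar_expand i j k : gammabar p M i j k =
  let r := frob_row p M in
    r i (ord3 0) * (r j (ord3 1) * r k (ord3 2) - r j (ord3 2) * r k (ord3 1))
  - r i (ord3 1) * (r j (ord3 0) * r k (ord3 2) - r j (ord3 2) * r k (ord3 0))
  + r i (ord3 2) * (r j (ord3 0) * r k (ord3 1) - r j (ord3 1) * r k (ord3 0)).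
Proof. by rewrite /gammabar det_matrix33. Qed.

Hypothesis g123 : gammabar p M 1 2 3 = 0.
Hypothesis g124 : gammabar p M 1 2 4 != 0.
Hypothesis g135 : gammabar p M 1 3 5 != 0.

Let c := cbar p M.
Let d := gammabar p M 2 3 4 / gammabar p M 1 2 4.

(* Cramer's rule: rows 1, 2, 3 are dependent and rows 1, 2, 4 are not. *)
Lemma c1_frob i : c1 M i ^+ p = c * c2 M i - d * c1 M i.
Proof.
suff : gammabar p M 1 2 4 * c1 M i ^+ p = gammabar p M 1 3 4 * c2 M i
          - gammabar p M 2 3 4 * c1 M i.
  by move=> eqc; apply: (mulfI g124); rewrite eqc /c /d /cbar; field.
have r1 j : frob_row p M 1 j = c1 M j by rewrite /frob_row /= expn0 expr1.
have r2 j : frob_row p M 2 j = c2 M j by rewrite /frob_row /= expn0 expr1.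
have r3 j : frob_row p M 3 j = c1 M j ^+ p by rewrite /frob_row /= expn1.
rewrite -r1 -r2 -r3; apply/eqP; rewrite -subr_eq0.
suff : gammabar p M 1 2 4 * frob_row p M 3 i -
   (gammabar p M 1 3 4 * frob_row p M 2 i - gammabar p M 2 3 4 * frob_row p M 1 i)
   = gammabar p M 1 2 3 * frob_row p M 4 i by move->; rewrite g123 mul0r.
rewrite !gammabar_expand /=.
case: i => [[|[|[|i]]] Hi] //; rewrite (bool_irrelevance Hi isT); ring.
Qed.

(** Thus [alpha] determines [beta]. This makes [f] invariant and, once [x] is inverted, leaves only
    translations by [alpha]. *)
Lemma alpha_frob a : alpha a ^+ p = c * beta a - d * alpha a.
Proof.
rewrite -[p in LHS]expn1 lin_frob -mulNr -!linZ -lin_plus.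
by apply: eq_bigr => i _; rewrite expn1 c1_frob mulNr.
Qed.

(** Otherwise [c1_frob] makes row 3 a multiple of row 1, and [gammabar 1 3 5] vanishes. *)
Lemma cbar_neq0 : c != 0.
Proof.
apply: contraNneq g135 => c0; rewrite gammabar_expand /=.
have r1 j : frob_row p M 1 j = c1 M j by rewrite /frob_row /= expn0 expr1.
have r3 j : frob_row p M 3 j = - d * c1 M j.
  by rewrite /frob_row /= expn1 c1_frob c0 mul0r sub0r mulNr.
by rewrite !r1 !r3; apply/eqP; ring.
Qed.

(** The Moore matrix of the first row of [M]. *)
Let A : 'M[F]_3 := \matrix_(r < 3, s < 3) c1 M s ^+ (p ^ r).

Lemma moore_unit : A \in unitmx.
Proof.
rewrite unitmxE unitfE; suff -> : \det A = gammabar p M 1 3 5 by [].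
rewrite /gammabar /A; congr (\det _); apply/matrixP => r s; rewrite !mxE /frob_row.
by case: r => [[|[|[|r]]] Hr].
Qed.

(** Raising [alpha a = 0] to the powers [1], [p], [p^2] puts the vector of entries of [a] in the
    kernel of the Moore matrix. The entries therefore vanish in [F], and their representatives are
    less than [p]. *)
Lemma alpha_inj : injective alpha.
Proof.
suff alpha0 a : alpha a = 0 -> a = 0.
  move=> a b eab; apply/eqP; rewrite -subr_eq0; apply/eqP/alpha0.
  by apply: (addIr (alpha b)); rewrite -linD subrK add0r.
move=> a0; pose v : 'cV[F]_3 := \col_s (a 0 s : nat)%:R.
have Av : A *m v = 0.
  apply/colP => r; rewrite !mxE.
  transitivity (alpha a ^+ (p ^ r)).
    by rewrite lin_frob; apply: eq_bigr => s _; rewrite !mxE mulrC.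
  by rewrite a0 expr0n expn_eq0; case: (p) p_prime.
have v0 : v = 0 by rewrite -[v](mulKmx moore_unit) Av mulmx0.
apply/rowP => s; rewrite mxE; apply/val_inj => /=.
have /eqP := congr1 (fun w : 'cV[F]_3 => w s 0) v0; rewrite !mxE.
rewrite -(dvdn_pcharf charF) => /dvdn_leq.
have lt : (a 0%R s < p)%N by rewrite -[X in (_ < X)%N](Fp_cast p_prime) ltn_ord.
by case: (nat_of_ord _) lt => // n lt /(_ isT); rewrite leqNgt lt.
Qed.

(** Inverting the Moore matrix gives an additive polynomial that vanishes at the three [c1 M i],
    hence on their span over the prime field. *)
Lemma alpha_moore : exists s : 'rV[F]_3, forall a,
  alpha a ^+ (p ^ 3) + s 0 (ord3 2) * alpha a ^+ (p ^ 2)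
     + s 0 (ord3 1) * alpha a ^+ p + s 0 (ord3 0) * alpha a = 0.
Proof.
pose w : 'rV[F]_3 := \row_i (- c1 M i ^+ (p ^ 3)).
exists (w *m invmx A) => a; set s := w *m invmx A.
have sA i : s 0 (ord3 2) * c1 M i ^+ (p ^ 2)
     + s 0 (ord3 1) * c1 M i ^+ p + s 0 (ord3 0) * c1 M i = - c1 M i ^+ (p ^ 3).
  have /rowP/(_ i) := mulmxKV moore_unit w; rewrite !mxE big_ord3 !mxE /= => <-.
  by rewrite expn1 expn0 expr1; ring.
have a1 : alpha a ^+ p = lin (fun i => c1 M i ^+ p) a by rewrite -[p in LHS]expn1 lin_frob expn1.
rewrite a1 !lin_frob -!linZ -!lin_plus; apply: big1 => i _.
by rewrite -[c1 M i ^+ (p ^ 3)]opprK -sA; ring.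
Qed.

End Action.

(** The lead terms cancel, so a nonzero difference would have more roots than its degree. *)
Lemma monic_eq_roots (R : idomainType) (P Q : {poly R}) (rs : seq R) :
  P \is monic -> Q \is monic -> size P = (size rs).+1 -> size Q = (size rs).+1 ->
  all (root P) rs -> all (root Q) rs -> uniq rs -> P = Q.
Proof.
move=> /monicP monP /monicP monQ sP sQ rP rQ uniq_rs; apply/eqP; rewrite -subr_eq0.
apply/negPn/negP => nz.
suff le : (size (P - Q)%R <= size rs)%N.
  suff : (size rs < size (P - Q)%R)%N by rewrite ltnNge le.
  apply: max_poly_roots => //; apply/allP => u u_rs.
  by rewrite rootE hornerE hornerN (eqP (allP rP u u_rs)) (eqP (allP rQ u u_rs)) subrr.
apply/leq_sizeP => j; rewrite leq_eqVlt coefB => /predU1P[<-|lt].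
  by have := monP; have := monQ; rewrite !lead_coefE sP sQ /= => -> ->; rewrite subrr.
by rewrite !nth_default ?subrr ?sP ?sQ.
Qed.

(** * Forms whose lead monomial is free of x *)

Section LeadModX.

Variable F : fieldType.
Implicit Types g : {mpoly F[3]}.

(** As [x] is the smallest variable, monomials divisible by [x] lie below all others of the same
    degree. *)
Lemma lead_mon_mod_vx g g' (m : 'X_{1..3}) : m (ord3 0) = 0%N ->
  g \is (mdeg m).-homog -> g = 'X_[m] + vx F * g' ->
  lead_mon g = m /\ lead_cf g = 1.
Proof.
move=> m0 homg gE.
have supx k : k \in msupp (vx F * g') -> (0 < k (ord3 0))%N.
  by rewrite mulrC (perm_mem (msuppMX _ _)) => /mapP[k' _ ->]; rewrite mnmDE mnm1E.
have xm : (vx F * g')@_m = 0.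
  by apply: memN_msupp_eq0; apply/negP => /supx; rewrite m0.
have gm : g@_m = 1 by rewrite gE mcoeffD mcoeffX eqxx xm addr0.
suff lm : lead_mon g = m by rewrite /lead_cf lm gm.
apply: lead_monE => [|k gk]; first by rewrite mcoeff_msupp gm oner_neq0.
have := gk; rewrite gE => /msuppD_le; rewrite mem_cat msuppX inE => /orP[/eqP|/supx k0].
  by left.
right; apply/grevlex_ltP; right; split; first by move/dhomogP: homg => /(_ k gk).
by exists (ord3 0); rewrite m0.
Qed.

Lemma dhomog_mulX g (m : 'X_{1..3}) d :
  'X_[m] * g \is (mdeg m + d).-homog -> g \is d.-homog.
Proof.
move=> /dhomogP homg; apply/dhomogP => k gk; apply/eqP.
by rewrite -(eqn_add2l (mdeg m)) -mdegD homg // mcoeff_msupp mulrC mcoeffMX -mcoeff_msupp.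
Qed.

Lemma dhomog_prod1 (I : finType) (E : I -> {mpoly F[3]}) :
  (forall i, E i \is 1.-homog) -> \prod_i E i \is #|I|.-homog.
Proof.
move=> homE; rewrite cardE -big_enum /=; elim: (enum I) => [|i s IHs].
  by rewrite big_nil; apply: dhomog1.
by rewrite big_cons /= -[(size s).+1]add1n; apply: dhomogM.
Qed.

End LeadModX.

(* The exponents of [x] are encoded by [t = x^(p^3-2p^2)], [v = x^(p-3)] and
   [s = x^(p^2-3p+1)], so that [x^(p^2-2p) = v x^2 s]. *)
Lemma htilde_identity (R : comNzRingType) (t v s x y z a b e w w2 g c d C1 C2 D1 D2 : R) :
  let u := v * x ^+ 2 * s in
  let g3 := t * u * (v * x ^+ 3) ^+ 2 in
  let d1 := a ^+ 2 - v * x ^+ 3 * w in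
  let f := a + c * ((y ^+ 2 - x * z) * (v * x)) + d * (y * (v * x ^+ 2)) in
  let fp := b + C1 * (d1 * u) + D1 * (a * (u * (v * x ^+ 3))) in
  let A := C1 * d1 + D1 * (a * (v * x ^+ 3)) in
  let B := c * (y ^+ 2 - x * z) + d * (y * x) in
  let G := v * x ^+ 4 * (g + C2 * w2 - D2 * b)
    + 2%:R * C2 * b * x * (D1 * a - C1 * w) + C2 * s * A ^+ 2
    - 4%:R * C2 * C1 * b * a * (d * y - c * z)
    - 2%:R * C2 * C1 * (b * v * B ^+ 2 + s * A * f ^+ 2) in
  e + g3 * g - (e + C2 * (b ^+ 2 * t - w2 * g3) + D2 * (b * g3))
  + C2 * (fp ^+ 2 * t) - 2%:R * (C2 * C1) * (fp * f ^+ 2 * (t * u))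
  = - 4%:R * (C2 * C1 * c) * (t * u * (v * x) * (b * a * y ^+ 2))
    + t * u * (v * x) * (x * G).
Proof. by move=> /=; ring. Qed.

(** * The orbit products and the invariants f and h *)

Section Invariants.

Variables (p : nat) (F : fieldType) (M : 'M[F]_(2, 3)).
Hypothesis p_prime : prime p.
Hypothesis p_gt2 : (2 < p)%N.
Hypothesis charF : p \in [pchar F].
Hypothesis g123 : gammabar p M 1 2 3 = 0.
Hypothesis g124 : gammabar p M 1 2 4 != 0.
Hypothesis g135 : gammabar p M 1 3 5 != 0.
Let G := 'rV['F_p]_3.
Let alpha := lin (c1 M) : G -> F.
Let beta := lin (c2 M) : G -> F.
Let c := cbar p M.
Let d := gammabar p M 2 3 4 / gammabar p M 1 2 4.
Let x := vx F.
Let y := vy F.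
Let z := vz F.
Let f := inv_f p M.

Let p_odd : odd p.
Proof. by case: (even_prime p_prime) p_gt2 => [->|]. Qed.

Lemma pchar_mpoly3 : p \in [pchar {mpoly F[3]}].
Proof.
move: charF; rewrite !inE p_prime /= => /eqP p0.
by rewrite -mpolyC_nat p0 mpolyC0.
Qed.

Let nzx : x != 0.
Proof. by rewrite -msupp_eq0 msuppX. Qed.

(** With a trivial stabiliser, the distinct images are indexed by the whole group. *)
Lemma orbit_prod_act g : injective (fun a : G => act M a g) ->
  orbit_prod p M g = \prod_(a : G) act M a g.
Proof.
move=> inj_g; rewrite /orbit_prod undup_id; last by rewrite map_inj_uniq ?enum_uniq.
by rewrite big_map big_enum.
Qed.

Lemma invariant_orbit_prod g : injective (fun a : G => act M a g) ->
  is_invariant p M (orbit_prod p M g).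
Proof.
move=> /orbit_prod_act -> b; rewrite act_shear /shear rmorph_prod /=.
rewrite [RHS](reindex_inj (addIr b)); apply: eq_bigr => a _.
by rewrite (actD M a b g p_prime charF) [RHS]act_shear.
Qed.

Let mcoeffZX c0 (i j : 'I_3) : ((c0 *: 'X_i : {mpoly F[3]})@_U_(j)) = c0 * (i == j)%:R.
Proof. by rewrite mcoeffZ mcoeffXU. Qed.

Lemma orbit_vy_inj : injective (fun a : G => act M a y).
Proof.
move=> a b /=; rewrite !act_shear !shear_vy.
move=> /(congr1 (mcoeff U_(ord3 0))); rewrite !mcoeffD !mcoeffZX !mulr1 => /addrI.
exact: (alpha_inj p_prime charF g135).
Qed.

(** The coefficient of [y] in the image of [z] is [2 alpha(a)], and [2] is invertible because
    [p > 2]. *)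
Lemma orbit_vz_inj : injective (fun a : G => act M a z).
Proof.
move=> a b /=; rewrite !act_shear !shear_vz.
move=> /(congr1 (mcoeff U_(ord3 1))); rewrite !mcoeffD !mcoeffZX !mulr1 !mulr0 !addr0 => /addrI.
have n2 : 2%:R != 0 :> F.
  by rewrite -(dvdn_pcharf charF) gtnNdvd.
move=> /(mulfI n2); exact: (alpha_inj p_prime charF g135).
Qed.

Lemma orbit_prod_vyE : orbit_prod p M y = \prod_(a : G) (y + alpha a *: x).
Proof.
rewrite (orbit_prod_act orbit_vy_inj); apply: eq_bigr => a _.
by rewrite act_shear shear_vy.
Qed.

Lemma card_G : #|{: G}| = (p ^ 3)%N.
Proof. by rewrite card_mx card_Fp // mul1n. Qed.

(* The roots [- alpha a x] of [N_G(y)], seen as a polynomial in [y], are those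
   of an additive polynomial with only p-power exponents. *)
Lemma orbit_prod_vy_mod : exists g,
  orbit_prod p M y = y ^+ (p ^ 3) + x ^+ (p ^ 3 - p ^ 2) * g.
Proof.
have [s sP] := alpha_moore p_prime charF g135.
have p1 : (1 < p)%N := ltnW p_gt2.
have le2 : (p ^ 2 <= p ^ 3)%N by rewrite leq_exp2l.
have le1 : (p <= p ^ 2)%N by rewrite -[X in (X <= _)%N]expn1 leq_exp2l.
have p0 : (0 < p)%N by rewrite prime_gt0.
pose r (a : G) := - (alpha a *: x).
pose P1 := \prod_(u <- [seq r a | a : G]) ('X - u%:P).
(* The polynomial of [alpha_moore], homogenised by powers of [x]. *)
pose P2 : {poly {mpoly F[3]}} := 'X^(p ^ 3)
  + ((s 0 (ord3 2))%:MP * x ^+ (p ^ 3 - p ^ 2))%:P * 'X^(p ^ 2)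
  + ((s 0 (ord3 1))%:MP * x ^+ (p ^ 3 - p))%:P * 'X^p
  + ((s 0 (ord3 0))%:MP * x ^+ (p ^ 3 - 1))%:P * 'X.
have size_lt k (u : {mpoly F[3]}) : (k < p ^ 3)%N -> (size (u%:P * 'X^k)%R <= p ^ 3)%N.
  move=> lt; rewrite mul_polyC (leq_trans (size_scale_leq _ _)) //.
  by rewrite size_polyXn.
have lt2 : (p ^ 2 < p ^ 3)%N by rewrite ltn_exp2l.
have P12 : P1 = P2.
  have sP2 : (size (P2 - 'X^(p ^ 3))%R <= p ^ 3)%N.
    have -> : P2 - 'X^(p ^ 3) = ((s 0 (ord3 2))%:MP * x ^+ (p ^ 3 - p ^ 2))%:P * 'X^(p ^ 2)
      + ((s 0 (ord3 1))%:MP * x ^+ (p ^ 3 - p))%:P * 'X^p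
      + ((s 0 (ord3 0))%:MP * x ^+ (p ^ 3 - 1))%:P * 'X^1 by rewrite /P2 expr1; ring.
    rewrite (leq_trans (size_polyD _ _)) // geq_max size_lt; last by lia.
    by rewrite (leq_trans (size_polyD _ _)) // geq_max !size_lt //; lia.
  have P2E : P2 = 'X^(p ^ 3) + (P2 - 'X^(p ^ 3)) by rewrite addrC subrK.
  have rootsP2 a : root P2 (r a).
    rewrite rootE !hornerE /r; have pk k : (- (alpha a *: x)) ^+ (p ^ k)
        = - (((alpha a) ^+ (p ^ k))%:MP * x ^+ (p ^ k)).
      rewrite exprNn -signr_odd oddX p_odd orbT mulN1r.
      by rewrite -mul_mpolyC exprMn rmorphXn.
    have := pk 1%N; rewrite expn1 => ->; rewrite !pk -[alpha a *: x]mul_mpolyC.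
    have xk k : (k <= p ^ 3)%N -> x ^+ (p ^ 3 - k) * x ^+ k = x ^+ (p ^ 3).
      by move=> le; rewrite -exprD subnK.
    set u := alpha a in sP *; apply/eqP; transitivity (- ((u ^+ (p ^ 3))%:MP * x ^+ (p ^ 3)
      + (s 0 (ord3 2))%:MP * (u ^+ (p ^ 2))%:MP * (x ^+ (p ^ 3 - p ^ 2) * x ^+ (p ^ 2))
      + (s 0 (ord3 1))%:MP * (u ^+ p)%:MP * (x ^+ (p ^ 3 - p) * x ^+ p)
      + (s 0 (ord3 0))%:MP * u%:MP * (x ^+ (p ^ 3 - 1) * x ^+ 1))); first by ring.
    rewrite !xk //; try by lia.
    by rewrite -!mulrDl -!rmorphM -!rmorphD /= sP mpolyC0 mul0r oppr0.
  apply: (@monic_eq_roots _ _ _ [seq r a | a : G]).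
  - exact: monic_prod_XsubC.
  - by rewrite monicE P2E lead_coefDl ?lead_coefXn // size_polyXn ltnS.
  - exact: size_prod_XsubC.
  - by rewrite P2E size_polyDl ?size_polyXn ?size_image ?card_G // ltnS.
  - by apply/allP => u; rewrite root_prod_XsubC.
  - by apply/allP => _ /mapP[a _ ->].
  - rewrite map_inj_uniq ?enum_uniq // => a b /oppr_inj.
    move=> /(congr1 (mcoeff U_(ord3 0))); rewrite !mcoeffZX !mulr1.
    exact: (alpha_inj p_prime charF g135).
(* The terms below [y^(p^3)], with the least power of [x] among them taken out. *)
exists ((s 0 (ord3 2))%:MP * y ^+ (p ^ 2) + x ^+ (p ^ 2 - p) *
        ((s 0 (ord3 1))%:MP * y ^+ p + x ^+ (p - 1) * ((s 0 (ord3 0))%:MP * y))).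
have -> : orbit_prod p M y = P1.[y].
  rewrite orbit_prod_vyE horner_prod big_image; apply: eq_bigr => a _.
  by rewrite hornerXsubC opprK.
have P2y : P2.[y] = y ^+ (p ^ 3) + (s 0 (ord3 2))%:MP * x ^+ (p ^ 3 - p ^ 2) * y ^+ (p ^ 2)
    + (s 0 (ord3 1))%:MP * x ^+ (p ^ 3 - p) * y ^+ p
    + (s 0 (ord3 0))%:MP * x ^+ (p ^ 3 - 1) * y by rewrite /P2 !hornerE.
rewrite P12 P2y.
have -> : (p ^ 3 - p = p ^ 3 - p ^ 2 + (p ^ 2 - p))%N by lia.
have -> : (p ^ 3 - 1 = p ^ 3 - p ^ 2 + (p ^ 2 - p) + (p - 1))%N by lia.
rewrite !exprD; ring.
Qed.

Lemma inv_fE : f = y ^+ p + c%:MP * ((y ^+ 2 - x * z) * x ^+ (p - 2))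
  + d%:MP * (y * x ^+ (p - 1)).
Proof. by rewrite !mul_mpolyC. Qed.

(** Under [a], [y^p] gains [(c beta - d alpha) x^p] by [alpha_frob], while [delta] loses [beta x^2]
    and [y] gains [alpha x]; the contributions to [f] cancel. *)
Lemma invariant_f : is_invariant p M f.
Proof.
apply/invariantP => a; rewrite inv_fE /shear.
have := alpha_frob p_prime charF g123 g124 a; rewrite -/c -/d -/alpha -/beta.
clearbody c d => frob_a.
set S := [tuple _; _; _].
have sx : vx F \mPo S = vx F := shear_vx _ _.
have sy : vy F \mPo S = vy F + alpha a *: vx F := shear_vy _ _.
have sz : vz F \mPo S = vz F + (2%:R * alpha a) *: vy F + (alpha a ^+ 2 + beta a) *: vx F
  := shear_vz _ _.
rewrite ?(rmorphB, rmorphD, rmorphXn, rmorphM) /= !comp_mpolyC.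
rewrite sx sy sz -/x -/y -/z -!mul_mpolyC.
have := frobD 1 y ((alpha a)%:MP * x) pchar_mpoly3; rewrite expn1 exprMn => ->.
rewrite -rmorphXn /= frob_a.
have -> : (p - 1 = p - 2 + 1)%N by lia.
have -> : x ^+ p = x ^+ (p - 2) * x ^+ 2 by rewrite -exprD; congr (_ ^+ _); lia.
rewrite !exprD ?(rmorphD, rmorphM, rmorphB, rmorphXn, rmorph_nat) /=; ring.
Qed.

Lemma inv_f_frob k : f ^+ (p ^ k) = y ^+ (p ^ k.+1)
  + (c ^+ (p ^ k))%:MP * (((y ^+ (p ^ k)) ^+ 2 - x ^+ (p ^ k) * z ^+ (p ^ k))
                          * x ^+ (p ^ k.+1 - 2 * p ^ k))
  + (d ^+ (p ^ k))%:MP * (y ^+ (p ^ k) * x ^+ (p ^ k.+1 - p ^ k)).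
Proof.
have frob u v : (u + v) ^+ (p ^ k) = u ^+ (p ^ k) + v ^+ (p ^ k) :> {mpoly F[3]}.
  exact: frobD pchar_mpoly3.
have frobN (u : {mpoly F[3]}) : (- u) ^+ (p ^ k) = - u ^+ (p ^ k).
  by rewrite exprNn -signr_odd oddX p_odd orbT mulN1r.
rewrite inv_fE; clearbody c d x y z; rewrite !frob !exprMn frob frobN exprMn -!rmorphXn /=.
have -> : (p ^ k.+1 - 2 * p ^ k = (p - 2) * p ^ k)%N by rewrite mulnBl expnS.
have -> : (p ^ k.+1 - p ^ k = (p - 1) * p ^ k)%N by rewrite mulnBl expnS mul1n.
by rewrite expnS !exprM [(x * z) ^+ _]exprMn.
Qed.

Let E := (p ^ 3 - p ^ 2 - p - 2)%N.
Let kappa := - 4%:R * c ^+ (p ^ 2 + p + 1).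

(** The later summands of [htilde] successively cancel the terms in [y^(p^3)], [y^(2 p^2)] and
    [y^(p^2 + 2 p)]. The cross term of [f^2] in the last summand then gives the term in [kappa], and
    what remains is divisible by a higher power of [x]. *)
Lemma htilde_split : exists g,
  htilde p M = kappa *: (x ^+ E * y ^+ (p ^ 2 + p + 2)) + x ^+ E.+1 * g.
Proof.
have [g Ny] := orbit_prod_vy_mod.
(* Since [p] is at least 3, these bounds make the truncated subtractions in the exponents exact. *)
have le2 : (3 * p <= p ^ 2)%N by rewrite -mulnn leq_mul2r p_gt2 orbT.
have le3 : (3 * p ^ 2 <= p ^ 3)%N by rewrite [(p ^ 3)%N]expnS leq_mul2r p_gt2 orbT.
pose t := x ^+ (p ^ 3 - 2 * p ^ 2); pose v := x ^+ (p - 3).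
pose s := x ^+ (p ^ 2 - 3 * p + 1).
have xE k l : k = l -> x ^+ k = x ^+ l by move=> ->.
have x2 : x ^+ (p - 2) = v * x by rewrite -exprSr; apply: xE; lia.
have x1 : x ^+ (p - 1) = v * x ^+ 2 by rewrite -exprD; apply: xE; lia.
have x0 : x ^+ p = v * x ^+ 3 by rewrite -exprD; apply: xE; lia.
have u0 : x ^+ (p ^ 2 - 2 * p) = v * x ^+ 2 * s by rewrite -!exprD; apply: xE; lia.
have u1 : x ^+ (p ^ 2 - p) = v * x ^+ 2 * s * (v * x ^+ 3).
  by rewrite -u0 -x0 -exprD; apply: xE; lia.
have t2 : x ^+ (p ^ 3 - p ^ 2 - 2 * p) = t * (v * x ^+ 2 * s).
  by rewrite -u0 -exprD; apply: xE; lia.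
have t3 : x ^+ (p ^ 3 - p ^ 2) = t * (v * x ^+ 2 * s) * (v * x ^+ 3) ^+ 2.
  by rewrite -u0 -x0 -exprM -!exprD; apply: xE; lia.
have tE : x ^+ E = t * (v * x ^+ 2 * s) * (v * x).
  by rewrite -u0 -x2 -!exprD; apply: xE; rewrite /E; lia.
have t4 : x ^+ (p ^ 2) * t = x ^+ (p ^ 3 - p ^ 2).
  by rewrite -exprD; apply: xE; lia.
have fE := inv_fE.
have := inv_f_frob 1; rewrite expn1 u0 u1 x0 => f1.
have f2 : f ^+ (p ^ 2) = y ^+ (p ^ 3)
    + (c ^+ (p ^ 2))%:MP * ((y ^+ (p ^ 2)) ^+ 2 * t - z ^+ (p ^ 2) * x ^+ (p ^ 3 - p ^ 2))
    + (d ^+ (p ^ 2))%:MP * (y ^+ (p ^ 2) * x ^+ (p ^ 3 - p ^ 2)).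
  by rewrite (inv_f_frob 2) -t4 /t; ring.
rewrite x2 x1 in fE; rewrite t3 in f2.
have := htilde_identity t v s x y z (y ^+ p) (y ^+ (p ^ 2)) (y ^+ (p ^ 3))
  (z ^+ p) (z ^+ (p ^ 2)) g c%:MP d%:MP (c ^+ p)%:MP (c ^+ (p ^ 2))%:MP
  (d ^+ p)%:MP (d ^+ (p ^ 2))%:MP.
rewrite /= -fE.
set G1 := (X in x * X) => idG; exists G1.
have kE : kappa%:MP_[3] = - 4%:R * ((c ^+ (p ^ 2))%:MP * (c ^+ p)%:MP * c%:MP).
  by rewrite /kappa !exprD expr1 !rmorphM rmorphN rmorph_nat.
have -> : kappa *: (x ^+ E * y ^+ (p ^ 2 + p + 2)) + x ^+ E.+1 * G1 =
    - 4%:R * ((c ^+ (p ^ 2))%:MP * (c ^+ p)%:MP * c%:MP)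
      * (t * (v * x ^+ 2 * s) * (v * x) * (y ^+ (p ^ 2) * y ^+ p * y ^+ 2))
    + t * (v * x ^+ 2 * s) * (v * x) * (x * G1).
  by rewrite -mul_mpolyC kE [x ^+ E.+1]exprSr tE !(exprD y) -[_ * x * G1]mulrA.
rewrite -idG /htilde Ny -/f -/c -/x f2 t2 t3 -/t -!mul_mpolyC [(2 * p)%N]mulnC exprM exprD f1.
by rewrite [f ^+ (p + 2)]exprD f1 !rmorphM rmorph_nat.
Qed.
Lemma kappa_neq0 : kappa != 0.
Proof.
rewrite /kappa mulf_neq0 ?expf_neq0 //; last first.
  exact: (cbar_neq0 g123 g124 g135).
have n2 : 2%:R != 0 :> F by rewrite -(dvdn_pcharf charF) gtnNdvd.
by rewrite oppr_eq0 (_ : 4%:R = 2%:R * 2%:R) ?mulf_neq0 // -natrM.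
Qed.

Let homx : x \is 1.-homog. Proof. by rewrite dhomogX; apply/eqP/mdeg1. Qed.
Let homy : y \is 1.-homog. Proof. by rewrite dhomogX; apply/eqP/mdeg1. Qed.
Let homz : z \is 1.-homog. Proof. by rewrite dhomogX; apply/eqP/mdeg1. Qed.

Let dhomog_eq e k (g : {mpoly F[3]}) : g \is e.-homog -> e = k -> g \is k.-homog.
Proof. by move=> homg <-. Qed.

Lemma dhomog_f : f \is p.-homog.
Proof.
apply: dhomogD; first apply: dhomogD.
- by apply: dhomog_eq (dhomogMn p homy) _; rewrite mul1n.
- apply/dhomogZ/(dhomog_eq (e := 2 + 1 * (p - 2))); last by lia.
  apply: dhomogM (dhomogMn _ homx); apply: dhomogD; first exact: (dhomogMn 2 homy).
  by rewrite dhomogN; apply: dhomogM homx homz.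
- apply/dhomogZ/(dhomog_eq (e := 1 + 1 * (p - 1))); last by lia.
  exact: dhomogM homy (dhomogMn _ homx).
Qed.

Lemma dhomog_orbit_prod_vy : orbit_prod p M y \is (p ^ 3).-homog.
Proof.
rewrite orbit_prod_vyE; apply: dhomog_eq (dhomog_prod1 _) card_G => a.
exact/dhomogD/dhomogZ.
Qed.

Lemma dhomog_htilde : htilde p M \is (p ^ 3).-homog.
Proof.
have le2 : (3 * p <= p ^ 2)%N by rewrite -mulnn leq_mul2r p_gt2 orbT.
have le3 : (3 * p ^ 2 <= p ^ 3)%N by rewrite [(p ^ 3)%N]expnS leq_mul2r p_gt2 orbT.
have pp := mulnn p.
have homM k l : (p * k + l = p ^ 3)%N -> f ^+ k * x ^+ l \is (p ^ 3).-homog.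
  move=> kl; apply: dhomog_eq (dhomogM (dhomogMn k dhomog_f) (dhomogMn l homx)) _.
  by rewrite mul1n.
rewrite /htilde; apply: dhomogD; last by rewrite dhomogN; apply/dhomogZ/homM; lia.
apply: dhomogD; last by apply/dhomogZ/homM; lia.
apply: dhomogD; first exact: dhomog_orbit_prod_vy.
by rewrite dhomogN; apply: dhomog_eq (dhomogMn _ dhomog_f) _; rewrite -expnS.
Qed.

Lemma invariant_orbit_prod_vy : is_invariant p M (orbit_prod p M y).
Proof. exact/invariant_orbit_prod/orbit_vy_inj. Qed.

Lemma invariant_htilde : is_invariant p M (htilde p M).
Proof.
have If := invariant_f.
have Ix : is_invariant p M (vx F) by apply: invariant_vx.
rewrite /htilde; apply: invariantB; last first.
  by apply: invariantZ; apply: invariantM; apply: invariantXn.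
apply: invariantD; last by apply: invariantZ; apply: invariantM; apply: invariantXn.
apply: invariantB; last exact: invariantXn.
exact: invariant_orbit_prod_vy.
Qed.

Lemma lead_mon_f : lead_mon f = (U_(ord3 1) *+ p)%MM /\ lead_cf f = 1.
Proof.
(* The witness is [(f - y^p) / x], a polynomial because [p] is at least 3. *)
apply: (@lead_mon_mod_vx _ _ (c%:MP * ((y ^+ 2 - x * z) * x ^+ (p - 3))
                              + d%:MP * (y * x ^+ (p - 2)))).
- by rewrite mulmnE mnm1E.
- by apply: dhomog_eq dhomog_f _; rewrite mdegMn mdeg1 mul1n.
rewrite inv_fE -mpolyXn -/(vy F) -/(vx F) -/x -/y -/z; clearbody c d.
have -> : (p - 1 = (p - 2).+1)%N by lia.
by have -> : (p - 2 = (p - 3).+1)%N by [lia]; rewrite !exprS; ring.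
Qed.

(** Dividing [htilde_split] by [kappa x^E] gives [h]. It inherits homogeneity and invariance from
    [htilde], as [x^E] is homogeneous, invariant and cancellable. *)
Lemma inv_h_exists : exists h, [/\ is_inv_h p M h, is_invariant p M h,
  lead_mon h = (U_(ord3 1) *+ (p ^ 2 + p + 2))%MM & lead_cf h = 1].
Proof.
have [g hE] := htilde_split.
have ku : kappa \is a GRing.unit by rewrite unitfE kappa_neq0.
pose h := y ^+ (p ^ 2 + p + 2) + x * (kappa^-1 *: g); exists h.
have hh : htilde p M = kappa *: (x ^+ E * h).
  rewrite hE /h mulrDr scalerDr exprSr -!mulrA; congr (_ + _).
  by rewrite -!scalerAr scalerA divrr // scale1r.
have le2 : (3 * p <= p ^ 2)%N by rewrite -mulnn leq_mul2r p_gt2 orbT.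
have le3 : (3 * p ^ 2 <= p ^ 3)%N by rewrite [(p ^ 3)%N]expnS leq_mul2r p_gt2 orbT.
have [lm lc] : lead_mon h = (U_(ord3 1) *+ (p ^ 2 + p + 2))%MM /\ lead_cf h = 1.
  apply: (@lead_mon_mod_vx _ _ (kappa^-1 *: g)); rewrite ?mulmnE ?mnm1E -?mpolyXn //.
  rewrite mdegMn mdeg1 mul1n; apply: (@dhomog_mulX _ _ (U_(ord3 0) *+ E)).
  rewrite -mpolyXn -[X in X \is _](scalerK kappa_neq0) -hh; apply: dhomogZ.
  by apply: dhomog_eq dhomog_htilde _; rewrite mdegMn mdeg1 /E; lia.
split=> //; apply/invariantP => a; have /invariantP/(_ a) := invariant_htilde.
rewrite hh /shear comp_mpolyZ rmorphM rmorphXn /= -/(shear _ _ _) => /(scalerI kappa_neq0).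
by rewrite -/(shear _ _ _) shear_vx => /(mulfI (expf_neq0 _ nzx)).
Qed.

Lemma lead_mon_orbit_prod_vz :
  lead_mon (orbit_prod p M z) = (U_(ord3 2) *+ (p ^ 3))%MM.
Proof.
rewrite (orbit_prod_act orbit_vz_inj).
have lmz a : lead_mon (act M a z) = U_(ord3 2)%MM.
  rewrite act_shear shear_vz; apply: lead_monE.
    by rewrite mcoeff_msupp !mcoeffD !mcoeffZ !mcoeffXU !mulr0 !addr0 oner_neq0.
  have lt (i : 'I_3) : (i < ord3 2)%N -> grevlex_lt U_(i)%MM U_(ord3 2)%MM.
    move=> lt_i; apply/grevlex_ltP; right; rewrite !mdeg1; split=> //.
    exists i; rewrite !mnm1E eqxx; split; first by case: eqP lt_i => // <-; rewrite ltnn.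
    move=> j ji; rewrite !mnm1E; case: eqP ji => [->|_]; first by rewrite ltnn.
    by case: eqP => // <- /(ltn_trans lt_i); rewrite ltnn.
  move=> m /msuppD_le; rewrite mem_cat => /orP[/msuppD_le|/msuppZ_le].
    rewrite mem_cat msuppX inE => /orP[/eqP->|/msuppZ_le]; first by left.
    by rewrite msuppX inE => /eqP->; right; apply: lt.
  by rewrite msuppX inE => /eqP->; right; apply: lt.
rewrite lead_mon_prod => [|a _].
  rewrite (eq_bigr (fun=> U_(ord3 2)%MM)) //; apply/mnmP => j.
  by rewrite mnm_sumE sum_nat_const mulmnE card_G mulnC.
rewrite -lead_cf_eq0 /lead_cf lmz act_shear shear_vz.
by rewrite !mcoeffD !mcoeffZ !mcoeffXU !mulr0 !addr0 oner_neq0.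
Qed.

End Invariants.

(** * Inverting x *)

(** By invariance [q] takes the value [q(0)] at every [- t i]. Since the differences of these points
    are units, [n] divides [q - q(0)]; the quotient is again invariant and has smaller degree. *)
Lemma shift_invariant_comp (K : idomainType) (I : finType) (t : I -> K)
    (n := \prod_i ('X + (t i)%:P)) (q : {poly K}) :
  (0 < #|I|)%N -> (forall i j, i != j -> t i - t j \is a GRing.unit) ->
  (forall i, n \Po ('X + (t i)%:P) = n) -> (forall i, q \Po ('X + (t i)%:P) = q) ->
  exists s, q = s \Po n.
Proof.
move=> I_gt0 unit_t inv_n; have nE : n = \prod_(u <- [seq - t i | i : I]) ('X - u%:P).
  by rewrite big_image; apply: eq_bigr => i _; rewrite polyCN opprK.
have size_n : size n = #|I|.+1 by rewrite nE size_prod_XsubC size_image.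
have nz_n : n != 0 by rewrite -size_poly_gt0 size_n.
have uniq_t : uniq_roots [seq - t i | i : I].
  rewrite /image_mem; elim: (enum I) (enum_uniq I) => //= i r IHr /andP[ir ur].
  rewrite IHr // andbT; apply/allP => _ /mapP[j jr ->].
  rewrite /diff_roots mulrC eqxx opprK addrC /= unit_t //.
  by apply: contraNneq ir => ->.
have [N] := ubnP (size q); elim: N q => // N IHN q ltN inv_q.
pose q0 := q - (q.[0])%:P.
have [u q0E] : exists u, q0 = u * n.
  rewrite nE; apply: uniq_roots_prod_XsubC => //; apply/allP => _ /mapP[i _ ->].
  rewrite rootE /q0 -{1}(inv_q i) hornerD hornerN hornerC horner_comp.
  by rewrite hornerD hornerX hornerC addNr subrr.
have qE : q = u * n + (q.[0])%:P by rewrite -q0E subrK.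
have [u0|nz_u] := eqVneq u 0.
  by exists (q.[0])%:P; rewrite comp_polyC {1}qE u0 mul0r add0r.
have [||s uE] := IHN u.
- rewrite ltnS in ltN; apply: leq_trans ltN.
  have : (size (u * n)%R <= size q)%N.
    rewrite -q0E (leq_trans (size_polyD _ _)) // geq_max leqnn size_polyN.
    apply: leq_trans (size_polyC_leq1 _) _; rewrite size_poly_gt0.
    apply: contraNneq nz_u => q00; move: q0E; rewrite /q0 q00 horner0 subr0 => /esym/eqP.
    by rewrite mulf_eq0 (negbTE nz_n) orbF.
  by rewrite size_mul // size_n addnS /=; apply: leq_trans; rewrite -addn1 leq_add2l.
- move=> i; apply: (mulIf nz_n); rewrite -{1}(inv_n i) -comp_polyM -q0E.
  by rewrite /q0 comp_polyB inv_q comp_polyC.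
exists (s * 'X + (q.[0])%:P).
by rewrite comp_polyD comp_polyM comp_polyX comp_polyC -uE -qE.
Qed.

Lemma mpoly_rmorph_eq (n : nat) (R S : comNzRingType)
    (f g : {rmorphism {mpoly R[n]} -> S}) :
  (forall a, f a%:MP = g a%:MP) -> (forall i, f 'X_i = g 'X_i) -> f =1 g.
Proof.
move=> fgC fgX q; rewrite [q]mpolyE !raddf_sum; apply: eq_bigr => m _ /=.
rewrite -mul_mpolyC !rmorphM fgC mpolyXE_id !rmorph_prod; congr (_ * _).
by apply: eq_bigr => i _; rewrite !rmorphXn fgX.
Qed.

Notation ord2 k := (@Ordinal 2 k isT).

(** * The coordinates x, Y and w *)

Section Coordinates.

Variables (F : fieldType) (p : nat) (c d : F).
Let K := {mpoly F[2]}.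
Let x : K := 'X_(ord2 0).
Let w : K := 'X_(ord2 1).

(* In terms of the coordinates [x], [Y = y / x] and [w = f / x^p] of F[V]_x the
   group acts by translations of [Y] only. *)
Definition xcoord_z : {poly K} :=
  x%:P * ('X^2 + (c^-1)%:MP%:P * ('X^p + d%:MP%:P * 'X - w%:P)).

(** The image of [z] results from solving [f = x^p w] for [z] with [y = x Y], which divides by
    [c]. *)
Definition xcoord : {mpoly F[3]} -> {poly K} :=
  mmap (polyC \o mpolyC 2 (R := F)) (tnth [tuple x%:P; x%:P * 'X; xcoord_z]).

HB.instance Definition _ := GRing.RMorphism.on xcoord.

Lemma xcoordC a : xcoord a%:MP = a%:MP%:P.
Proof. by rewrite /xcoord mmapC. Qed.

Lemma xcoord_vx : xcoord (vx F) = x%:P.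
Proof. by rewrite /xcoord mmapX mmap1U. Qed.

Lemma xcoord_vy : xcoord (vy F) = x%:P * 'X.
Proof. by rewrite /xcoord mmapX mmap1U. Qed.

Lemma xcoord_vz : xcoord (vz F) = xcoord_z.
Proof. by rewrite /xcoord mmapX mmap1U. Qed.

Hypothesis nzc : c != 0.
Hypothesis p_prime : prime p.
Hypothesis charF : p \in [pchar F].

Lemma xcoord_shear a b g : a ^+ p = c * b - d * a ->
  xcoord (shear a b g) = xcoord g \Po ('X + a%:MP%:P).
Proof.
move=> frob_a; move: g; pose S := ('X + a%:MP%:P : {poly K}).
apply: (@mpoly_rmorph_eq _ _ _
  [the {rmorphism {mpoly F[3]} -> {poly K}} of xcoord \o comp_mpoly
    [tuple vx F; vy F + a *: vx F; vz F + (2%:R * a) *: vy F + (a ^+ 2 + b) *: vx F]]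
  [the {rmorphism {mpoly F[3]} -> {poly K}} of comp_poly S \o xcoord]) => [e|i] /=.
  by rewrite comp_mpolyC xcoordC comp_polyC.
have charK : p \in [pchar {poly K}].
  move: charF; rewrite !inE p_prime /= => /eqP p0.
  by rewrite -(rmorph_nat polyC) -mpolyC_nat p0 mpolyC0.
(* The relation solved for [b], so that the image of the sheared [z] involves [a] only. *)
have bE : b%:MP = (c^-1)%:MP * (a%:MP ^+ p + d%:MP * a%:MP) :> K.
  by rewrite -rmorphXn -!rmorphM -rmorphD -rmorphM /= frob_a subrK mulKf.
case: i => [[|[|[|i]]] Hi] //; rewrite (bool_irrelevance Hi isT).
- by rewrite -/(shear _ _ _) -/(vx F) shear_vx xcoord_vx comp_polyC.
- rewrite -/(shear _ _ _) -/(vy F) shear_vy -mul_mpolyC rmorphD rmorphM /= xcoordC.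
  by rewrite xcoord_vx xcoord_vy comp_polyM comp_polyC comp_polyX; rewrite /S; ring.
rewrite -/(shear _ _ _) -/(vz F) shear_vz -!mul_mpolyC !(rmorphD, rmorphM) /= !xcoordC.
rewrite xcoord_vx xcoord_vy xcoord_vz /xcoord_z bE.
rewrite !(comp_polyM, comp_polyB, comp_polyD, comp_Xn_poly, comp_polyX, comp_polyC).
have -> : S ^+ p = 'X^p + a%:MP%:P ^+ p.
  by have := frobD 1 ('X : {poly K}) a%:MP%:P charK; rewrite expn1.
rewrite /S !(rmorphD, rmorphM, rmorphXn) /= ?rmorph1; ring.
Qed.

End Coordinates.

Notation mfrac := (@tofrac {mpoly _[3]}).

(** Here [yp] and [xp] stand for [y^p] and [x^(p - 2)], which keeps symbolic exponents away from
    [field]. *)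
Lemma coord_z_identity (L : fieldType) (y z d yp x xp c : L) :
  x != 0 -> xp != 0 -> c != 0 ->
  x * ((y / x) ^+ 2 + c^-1 * (yp / (xp * x ^+ 2) + d * (y / x)
    - (yp + c * ((y ^+ 2 - x * z) * xp) + d * (y * (xp * x))) / (xp * x ^+ 2))) = z.
Proof. by move=> nzx nzxp nzc; field; rewrite nzc nzx nzxp. Qed.

(** * The inverse change of coordinates, in the fraction field *)

Section Localisation.

Variables (F : fieldType) (p : nat) (c d : F).
Let L := {fraction {mpoly F[3]}}.
Let x : L := mfrac (vx F).
Let y : L := mfrac (vy F).
Let f : {mpoly F[3]} := vy F ^+ p + c%:MP * ((vy F ^+ 2 - vx F * vz F) * vx F ^+ (p - 2))
  + d%:MP * (vy F * vx F ^+ (p - 1)).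

Definition uncoord0 : {mpoly F[2]} -> L :=
  mmap (mfrac \o mpolyC 3 (R := F)) (tnth [tuple x; mfrac f / x ^+ p]).

HB.instance Definition _ := GRing.RMorphism.on uncoord0.

Definition uncoord : {poly {mpoly F[2]}} -> L :=
  horner_eval (y / x) \o map_poly uncoord0.

HB.instance Definition _ := GRing.RMorphism.on uncoord.

Hypothesis nzc : c != 0.
Hypothesis p_gt1 : (1 < p)%N.

Lemma uncoord_polyC a : uncoord a%:P = uncoord0 a.
Proof. by rewrite /uncoord /= map_polyC /= /horner_eval hornerC. Qed.

Lemma uncoord0C a : uncoord0 a%:MP = mfrac a%:MP.
Proof. by rewrite /uncoord0 mmapC. Qed.

Lemma uncoord0_x : uncoord0 'X_(ord2 0) = x.
Proof. by rewrite /uncoord0 mmapX mmap1U. Qed.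

Lemma uncoord0_w : uncoord0 'X_(ord2 1) = mfrac f / x ^+ p.
Proof. by rewrite /uncoord0 mmapX mmap1U. Qed.

Lemma uncoordX : uncoord 'X = y / x.
Proof. by rewrite /uncoord /= map_polyX /= /horner_eval hornerX. Qed.

Let nzx : x != 0.
Proof. by rewrite tofrac_eq0 -msupp_eq0 msuppX. Qed.

Lemma uncoordK g : uncoord (xcoord p c d g) = mfrac g.
Proof.
move: g; apply: (@mpoly_rmorph_eq _ _ _
  [the {rmorphism {mpoly F[3]} -> L} of uncoord \o xcoord p c d]
  [the {rmorphism {mpoly F[3]} -> L} of mfrac]) => [a|i] /=.
  by rewrite xcoordC uncoord_polyC uncoord0C.
case: i => [[|[|[|i]]] Hi] //; rewrite (bool_irrelevance Hi isT).
- by rewrite xcoord_vx uncoord_polyC uncoord0_x.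
- rewrite xcoord_vy rmorphM /= uncoord_polyC uncoord0_x uncoordX mulrC.
  by rewrite divfK.
have Cc : (mfrac c%:MP : L) != 0 by rewrite tofrac_eq0 mpolyC_eq0.
rewrite xcoord_vz /xcoord_z !(rmorphM, rmorphB, rmorphD, rmorphXn) /= !uncoord_polyC.
rewrite uncoord0_x uncoord0_w !uncoord0C uncoordX expr_div_n /f.
have -> : mfrac (c^-1)%:MP = (mfrac c%:MP)^-1 :> L.
  by apply: (mulfI Cc); rewrite -rmorphM -mpolyCM !divff // mpolyC1 rmorph1.
have -> : (p - 1 = (p - 2) + 1)%N by lia.
rewrite !(rmorphM, rmorphB, rmorphD, rmorphXn) /= -/x -/y.
have xp : x ^+ p = x ^+ (p - 2) * x ^+ 2 by rewrite -exprD; congr (_ ^+ _); lia.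
rewrite xp exprD.
have nz2 : x ^+ (p - 2) != 0 by exact: expf_neq0 nzx.
exact: (coord_z_identity _ _ _ _ nzx nz2 Cc).
Qed.

End Localisation.

(** * Degree in the third generator after inverting x *)

Section LocalisedSubalgebra.

Variables (F : fieldType) (B : 4.-tuple {mpoly F[3]}).
Hypothesis B0 : tnth B (ord4 0) = vx F.
Let x := mfrac (vx F).
Implicit Types l : {fraction {mpoly F[3]}}.

(* [l] lies in the localisation at [x] of the algebra generated by [B], with
   degree at most [d] in the third generator. *)
Definition loc d l := exists k T, deg_le (ord4 2) d T /\ x ^+ k * l = mfrac (T \mPo B).

Lemma loc_comp d T : deg_le (ord4 2) d T -> loc d (mfrac (T \mPo B)).
Proof. by move=> dT; exists 0%N, T; rewrite mul1r. Qed.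

Lemma comp_xn k : 'X_(ord4 0) ^+ k \mPo B = vx F ^+ k.
Proof. by rewrite rmorphXn /= comp_mpolyXU -B0 (tnth_nth 0). Qed.

Lemma deg_le_xn k : deg_le (ord4 2) 0 ('X_(ord4 0) ^+ k : {mpoly F[4]}).
Proof. by rewrite -[0%N]/(0 * k)%N; apply/deg_leXn/deg_leX; rewrite mnm1E. Qed.

Lemma locD d l1 l2 : loc d l1 -> loc d l2 -> loc d (l1 + l2).
Proof.
move=> [k1 [T1 [d1 e1]]] [k2 [T2 [d2 e2]]].
exists (k1 + k2)%N, ('X_(ord4 0) ^+ k2 * T1 + 'X_(ord4 0) ^+ k1 * T2); split.
  by apply: deg_leD; rewrite -[d]add0n; apply: deg_leM => //; apply: deg_le_xn.
rewrite !rmorphD !(rmorphM (comp_mpoly B)) /= !comp_xn !rmorphM /= -e1 -e2 !rmorphXn /= -/x.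
by rewrite exprD; ring.
Qed.

Lemma locM d e l1 l2 : loc d l1 -> loc e l2 -> loc (d + e) (l1 * l2).
Proof.
move=> [k1 [T1 [d1 e1]]] [k2 [T2 [d2 e2]]].
exists (k1 + k2)%N, (T1 * T2); split; first exact: deg_leM.
by rewrite (rmorphM (comp_mpoly B)) rmorphM /= -e1 -e2 exprD; ring.
Qed.

Lemma locW d e l : (d <= e)%N -> loc d l -> loc e l.
Proof. by move=> de [k [T [dT eT]]]; exists k, T; split=> //; apply: deg_leW dT. Qed.

Lemma locC a : loc 0 (mfrac a%:MP).
Proof. by rewrite -(comp_mpolyC a B); apply/loc_comp/deg_leC. Qed.

Lemma loc0 d : loc d 0.
Proof. by rewrite -(rmorph0 mfrac) -(comp_mpoly0 B); apply/loc_comp/deg_le0. Qed.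

Lemma loc1 d : loc d 1.
Proof. by apply: (@locW 0) => //; rewrite -(rmorph1 mfrac) -mpolyC1; apply: locC. Qed.

Lemma locXn d l k : loc d l -> loc (d * k) (l ^+ k).
Proof.
move=> dl; elim: k => [|k IHk]; first by rewrite expr0; apply: loc1.
by rewrite exprS mulnS; apply: locM.
Qed.

Lemma loc_x : loc 0 x.
Proof. by rewrite /x -[vx F]expr1 -comp_xn; apply/loc_comp/deg_le_xn. Qed.

Let nzx : x != 0.
Proof. by rewrite tofrac_eq0 -msupp_eq0 msuppX. Qed.

Lemma loc_xV k : loc 0 (x ^- k).
Proof.
exists k, 1; split; first by rewrite -mpolyC1; apply: deg_leC.
by rewrite comp_mpoly1 tofrac1; apply/divff/expf_neq0/nzx.
Qed.

Lemma loc_sum d (I : Type) (s : seq I) (P : pred I) (E : I -> {fraction {mpoly F[3]}}) :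
  (forall i, P i -> loc d (E i)) -> loc d (\sum_(i <- s | P i) E i).
Proof. by move=> dE; elim/big_ind: _ => [||i /dE //]; [apply: loc0 | apply: locD]. Qed.

Lemma loc_prod0 (I : Type) (s : seq I) (P : pred I) (E : I -> {fraction {mpoly F[3]}}) :
  (forall i, P i -> loc 0 (E i)) -> loc 0 (\prod_(i <- s | P i) E i).
Proof.
by move=> dE; elim/big_ind: _ => [||i /dE //]; [apply: loc1 | move=> u v; apply: (@locM 0 0)].
Qed.

Lemma loc_polynomial d g : loc d (mfrac g) ->
  exists k T, deg_le (ord4 2) d T /\ vx F ^+ k * g = T \mPo B.
Proof.
move=> [k [T [dT eT]]]; exists k, T; split=> //; apply/eqP.
by rewrite -tofrac_eq rmorphM rmorphXn /= eT.
Qed.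

End LocalisedSubalgebra.

(** * Invariants as polynomials in h over the localised algebra *)

Section InvariantRing.

Variables (p : nat) (F : fieldType) (M : 'M[F]_(2, 3)).
Hypothesis p_prime : prime p.
Hypothesis p_gt2 : (2 < p)%N.
Hypothesis charF : p \in [pchar F].
Hypothesis g123 : gammabar p M 1 2 3 = 0.
Hypothesis g124 : gammabar p M 1 2 4 != 0.
Hypothesis g135 : gammabar p M 1 3 5 != 0.
Let G := 'rV['F_p]_3.
Let alpha := lin (c1 M) : G -> F.
Let beta := lin (c2 M) : G -> F.
Let c := cbar p M.
Let d := gammabar p M 2 3 4 / gammabar p M 1 2 4.
Let f := inv_f p M.
Let Ny := orbit_prod p M (vy F).
Let Nz := orbit_prod p M (vz F).
Let E := (p ^ 3 - p ^ 2 - p - 2)%N.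
Let kappa := - 4%:R * c ^+ (p ^ 2 + p + 1).
Variable h : {mpoly F[3]}.
Hypothesis hP : is_inv_h p M h.
Let B := [tuple vx F; f; h; Nz].
Let x := mfrac (vx F).

Let nzc : c != 0.
Proof. exact: (cbar_neq0 g123 g124 g135). Qed.

Let p_gt0 : (0 < p)%N.
Proof. exact: prime_gt0. Qed.

Let nzx : x != 0.
Proof. by rewrite tofrac_eq0 -msupp_eq0 msuppX. Qed.

Let B0 : tnth B (ord4 0) = vx F.
Proof. by []. Qed.

(** The product of the translates of [Y], which is [N_G(y) / x^(p^3)] in the original
    coordinates. *)
Let n : {poly {mpoly F[2]}} := \prod_(a : G) ('X + (alpha a)%:MP%:P).

Lemma trans_poly_shift a : n \Po ('X + (alpha a)%:MP%:P) = n.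
Proof.
rewrite /n rmorph_prod [RHS](reindex_inj (addrI a)); apply: eq_bigr => b _ /=.
rewrite comp_polyD comp_polyX comp_polyC /alpha (linD p_prime charF).
by rewrite mpolyCD polyCD addrA.
Qed.

Lemma xcoord_invariant g : is_invariant p M g -> exists s, xcoord p c d g = s \Po n.
Proof.
move=> /invariantP inv_g; apply: shift_invariant_comp.
- by rewrite (card_G p_prime) expn_gt0 p_gt0.
- move=> a b ne; rewrite -mpolyCB; apply: rmorph_unit; rewrite unitfE subr_eq0.
  by apply: contra_neq ne; apply: (alpha_inj p_prime charF g135).
- exact: trans_poly_shift.
move=> a; rewrite -(@xcoord_shear _ _ _ _ nzc p_prime charF _ (beta a)) ?inv_g //.
exact: (alpha_frob p_prime charF g123 g124).
Qed.

Lemma uncoord_trans_poly : uncoord p c d n = mfrac Ny / x ^+ (p ^ 3).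
Proof.
apply: (mulIf (expf_neq0 (p ^ 3) nzx)); rewrite divfK ?expf_neq0 //.
rewrite /Ny (orbit_prod_vyE p_prime charF g135) !rmorph_prod /=.
rewrite -[in X in x ^+ X](card_G p_prime) -prodr_const -big_split /=.
apply: eq_bigr => a _; rewrite rmorphD /= uncoordX uncoord_polyC uncoord0C.
by rewrite -mul_mpolyC rmorphD rmorphM /= mulrDl divfK.
Qed.

Lemma uncoord_comp s : uncoord p c d (s \Po n) =
  \sum_(i < size s) uncoord0 p c d s`_i * (mfrac Ny / x ^+ (p ^ 3)) ^+ i.
Proof.
rewrite -uncoord_trans_poly /uncoord /= map_comp_poly /horner_eval horner_comp.
rewrite (@horner_coef_wide _ (size s)) ?size_poly //.
by apply: eq_bigr => i _; rewrite coef_map.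
Qed.

Let loc_f : loc B 0 (mfrac f).
Proof.
have <- : 'X_(ord4 1) \mPo B = f by rewrite comp_mpolyXU.
by apply/loc_comp/deg_leX; rewrite mnm1E.
Qed.

(** Such elements are polynomials in [x] and [w = f / x^p], where [h] does not occur. *)
Lemma loc_uncoord0 q : loc B 0 (uncoord0 p c d q).
Proof.
rewrite /uncoord0 /mmap; apply: (loc_sum B0) => m _; apply: (@locM _ _ 0 0); first exact: locC.
apply: loc_prod0 => i _; apply: (@locXn _ _ 0).
case: i => [[|[|i]] Hi] //; rewrite (tnth_nth 0) /=; first exact: (loc_x B0).
by rewrite -inv_fE; apply: (@locM _ _ 0 0); [apply: loc_f | apply: loc_xV].
Qed.

Let loc_h : loc B 1 (mfrac h).
Proof.
have <- : 'X_(ord4 2) \mPo B = h by rewrite comp_mpolyXU.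
by apply/loc_comp/deg_leX; rewrite mnm1E.
Qed.

Let loc0M l1 l2 : loc B 0 l1 -> loc B 0 l2 -> loc B 0 (l1 * l2).
Proof. exact: (@locM _ _ 0 0). Qed.

Let loc0Xn l k : loc B 0 l -> loc B 0 (l ^+ k).
Proof. exact: (@locXn _ _ 0). Qed.

(** The defining equation of [h], solved for [N_G(y)]. It turns polynomials in [N_G(y)] into
    polynomials in [h] of the same degree bound. *)
Lemma orbit_prod_vy_h : exists2 u, loc B 0 u & mfrac Ny = u + mfrac kappa%:MP * x ^+ E * mfrac h.
Proof.
pose v := f ^+ (p ^ 2)
  - (c ^+ (p ^ 2))%:MP * (f ^+ (2 * p) * vx F ^+ (p ^ 3 - 2 * p ^ 2))
  + (2%:R * c ^+ (p ^ 2 + p))%:MP * (f ^+ (p + 2) * vx F ^+ (p ^ 3 - p ^ 2 - 2 * p)).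
exists (mfrac v).
  rewrite /v !(rmorphD, rmorphB, rmorphN) /=; apply: (locD B0); first apply: (locD B0).
  - by rewrite rmorphXn; apply: loc0Xn.
  - rewrite -tofracN -mulNr -mpolyCN rmorphM; apply: loc0M; first exact: locC.
    by rewrite rmorphM !rmorphXn; apply: loc0M; apply: loc0Xn; [apply: loc_f | apply: (loc_x B0)].
  - rewrite rmorphM; apply: loc0M; first exact: locC.
    by rewrite rmorphM !rmorphXn; apply: loc0M; apply: loc0Xn; [apply: loc_f | apply: (loc_x B0)].
rewrite -rmorphXn -!rmorphM -rmorphD; congr mfrac.
move: hP; rewrite /is_inv_h /htilde -!mul_mpolyC -/Ny -/f -/c -/kappa -/E => hh.
by rewrite -mulrA -hh /v; ring.
Qed.

Lemma loc_invariant g : is_invariant p M g -> exists e, loc B e (mfrac g).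
Proof.
(* A crude bound is enough: division by the monic relation will bring the degree below [p]. *)
move=> /xcoord_invariant[s gs]; exists (size s).
rewrite -(uncoordK d nzc (ltnW p_gt2)) gs uncoord_comp; apply: (loc_sum B0) => i _.
apply: (@locM _ _ 0 (size s)); first exact: loc_uncoord0.
apply: (@locW _ _ (1 * i)); first by rewrite mul1n ltnW.
apply: locXn; apply: (@locM _ _ 1 0); last exact: loc_xV.
have [u lu ->] := orbit_prod_vy_h; apply: (locD B0); first by apply: locW lu.
apply: (@locM _ _ 0 1); last exact: loc_h.
apply: loc0M; first exact: locC.
exact/loc0Xn/(loc_x B0).
Qed.

Lemma size_trans_poly : size n = (p ^ 3).+1.
Proof.
have -> : n = \prod_(u <- [seq - (alpha a)%:MP | a : G]) ('X - u%:P).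
  by rewrite big_image; apply: eq_bigr => a _; rewrite polyCN opprK.
by rewrite size_prod_XsubC size_image card_G.
Qed.

Lemma trans_poly_monic : n \is monic.
Proof. by apply: monic_prod => a _; apply: monicXaddC. Qed.

Let xc : {mpoly F[2]} := 'X_(ord2 0) * (c^-1)%:MP.

(** As [p > 2], the term in [Y^p] dominates the one in [Y^2]. *)
Lemma xcoord_z_top : size (xcoord_z p c d) = p.+1 /\ lead_coef (xcoord_z p c d) = xc.
Proof.
pose r : {poly {mpoly F[2]}} := c%:MP%:P * 'X^2 + d%:MP%:P * 'X^1 - ('X_(ord2 1))%:P.
have zE : xcoord_z p c d = xc%:P * ('X^p + r).
  rewrite /xcoord_z /r /xc expr1 polyCM.
  have ccV : (c^-1)%:MP%:P * c%:MP%:P = 1 :> {poly {mpoly F[2]}}.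
    by rewrite -rmorphM -mpolyCM mulVf // mpolyC1 polyC1.
  rewrite -[X in _ * (X + _) = _]mul1r -ccV; ring.
have size_r : (size r < p.+1)%N.
  have sX k (u : {mpoly F[2]}) : (size (u%:P * 'X^k)%R <= k.+1)%N.
    by rewrite mul_polyC (leq_trans (size_scale_leq _ _)) // size_polyXn.
  rewrite ltnS (leq_trans _ p_gt2) // /r.
  rewrite (leq_trans (size_polyD _ _)) // geq_max size_polyN; apply/andP; split.
    by rewrite (leq_trans (size_polyD _ _)) // geq_max !(leq_trans (sX _ _)).
  by rewrite (leq_trans (size_polyC_leq1 _)).
have nz_xc : xc != 0.
  by rewrite mulf_neq0 // ?mpolyC_eq0 ?invr_eq0 // -msupp_eq0 msuppX.
rewrite zE lead_coefM lead_coefC lead_coefDl ?size_polyXn // lead_coefXn mulr1.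
by rewrite size_Cmul // size_polyDl ?size_polyXn.
Qed.

Lemma xcoord_orbit_prod_vz :
  xcoord p c d Nz = \prod_(a : G) (xcoord_z p c d \Po ('X + (alpha a)%:MP%:P)).
Proof.
rewrite /Nz (orbit_prod_act (orbit_vz_inj p_prime p_gt2 charF g135)) rmorph_prod.
apply: eq_bigr => a _; rewrite act_shear /= (@xcoord_shear _ _ _ _ nzc p_prime charF) ?xcoord_vz //.
exact: (alpha_frob p_prime charF g123 g124).
Qed.

Lemma xcoord_orbit_prod_vz_top : size (xcoord p c d Nz) = (p ^ 4).+1 /\
  lead_coef (xcoord p c d Nz) = xc ^+ (p ^ 3).
Proof.
have [sz lz] := xcoord_z_top.
have s1 (a : G) : size (xcoord_z p c d \Po ('X + (alpha a)%:MP%:P)) = p.+1.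
  by rewrite size_comp_poly2 ?size_XaddC.
rewrite xcoord_orbit_prod_vz; split.
  rewrite size_prod => [|a _]; last by rewrite -size_poly_gt0 s1.
  rewrite (eq_bigr (fun=> p.+1)) // sum_nat_const (card_G p_prime).
  by rewrite [(p ^ 4)%N]expnSr mulnS subSn ?leq_addr // addKn.
rewrite lead_coef_prod (eq_bigr (fun=> xc)) ?prodr_const ?(card_G p_prime) // => a _.
by rewrite lead_coef_comp ?size_XaddC // lz (monicP (monicXaddC _)) expr1n mulr1.
Qed.

(** Comparing degrees in [Y], [p^4 = (deg s) p^3], so [s] has degree [p]. Its lower terms have
    degree less than [p] in [h], and in its top term Frobenius splits [N_G(y)^p] into an [h]-free
    part and a multiple of [h^p]. *)
Lemma loc_orbit_prod_vz : exists2 a, a != 0 &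
  loc B p.-1 (mfrac (vx F ^+ (p ^ 2 + 2 * p) * Nz - a%:MP * h ^+ p)).
Proof.
have invNz : is_invariant p M Nz.
  exact/(invariant_orbit_prod p_prime charF)/(orbit_vz_inj p_prime p_gt2 charF g135).
have [s sE] := xcoord_invariant invNz.
have [sizeN leadN] := xcoord_orbit_prod_vz_top.
have size_s : size s = p.+1.
  have := size_comp_poly s n; rewrite -sE sizeN size_trans_poly /= expnS => /eqP.
  rewrite eqn_pmul2r ?expn_gt0 ?p_gt0 // => /eqP ->; rewrite prednK // size_poly_gt0.
  by apply/eqP => s0; move: sizeN; rewrite sE s0 comp_poly0 size_poly0.
have lead_s : s`_p = xc ^+ (p ^ 3).
  rewrite -leadN sE lead_coef_comp; last by rewrite size_trans_poly ltnS expn_gt0 p_gt0.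
  by rewrite (monicP trans_poly_monic) expr1n mulr1 lead_coefE size_s.
have [u lu NyE] := orbit_prod_vy_h.

pose N := (p ^ 3)%N; pose e := (p ^ 2 + 2 * p)%N.
(* The factor [c^-N] is the constant in the lead coefficient of [s], and [kappa^p] comes from
   [N_G(y)^p]. *)
exists (c^-1 ^+ N * kappa ^+ p).
  by rewrite mulf_neq0 // expf_neq0 ?invr_eq0 //; apply: kappa_neq0.
have zE : mfrac Nz = \sum_(i < size s) uncoord0 p c d s`_i * (mfrac Ny / x ^+ N) ^+ i.
  by rewrite -(uncoordK d nzc (ltnW p_gt2)) sE uncoord_comp.
rewrite size_s big_ord_recr /= lead_s in zE.
set t := \sum_(i < p) _ in zE.
have lt : loc B p.-1 t.
  apply: (loc_sum B0) => i _; apply: (@locM _ _ 0 p.-1); first exact: loc_uncoord0.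
  apply: (@locW _ _ (1 * i)); first by rewrite mul1n -ltnS prednK.
  apply: locXn; apply: (@locM _ _ 1 0); last exact: loc_xV.
  rewrite NyE; apply: (locD B0); first exact: locW lu.
  apply: (@locM _ _ 0 1); last exact: loc_h.
  by apply: loc0M; [apply: locC | apply/loc0Xn/(loc_x B0)].
have xcE : uncoord0 p c d (xc ^+ N) = (x * mfrac (c^-1)%:MP) ^+ N.
  by rewrite rmorphXn rmorphM /= uncoord0_x uncoord0C.
(* The [h]-free part of the top term. *)
pose r := (x * mfrac (c^-1)%:MP) ^+ N * (u / x ^+ N) ^+ p.
have lr : loc B 0 r.
  apply: (@locM _ _ 0 0); apply: (@locXn _ _ 0); apply: (@locM _ _ 0 0) => //.
  - exact: loc_x.
  - exact: locC.
  - exact: loc_xV.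
suff -> : mfrac (vx F ^+ e * Nz - (c^-1 ^+ N * kappa ^+ p)%:MP * h ^+ p) = x ^+ e * (t + r).
  apply: (@locM _ _ 0 p.-1); first exact/(@locXn _ _ 0)/(loc_x B0).
  by apply: (locD B0) => //; apply: locW lr.
have charL : p \in [pchar {fraction {mpoly F[3]}}].
  have := pchar_mpoly3 p_prime charF; rewrite !inE p_prime /= => /eqP p0.
  by rewrite -(rmorph_nat mfrac) p0 rmorph0.
have NypE : (mfrac Ny / x ^+ N) ^+ p =
    (u / x ^+ N) ^+ p + (mfrac kappa%:MP * x ^+ E * mfrac h / x ^+ N) ^+ p.
  by rewrite NyE mulrDl; have := frobD 1 (u / x ^+ N) _ charL; rewrite expn1 => ->.
(* This explains the exponent [e]: it makes all powers of [x] cancel in the coefficient of [h^p], as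
   [e + p^3 + E p = p^4]. *)
have xexp : x ^+ e * (x ^+ N * (x ^+ E) ^+ p) = (x ^+ N) ^+ p.
  rewrite -!exprM -!exprD; congr (_ ^+ _); rewrite /e /N /E.
  have le2 : (3 * p <= p ^ 2)%N by rewrite -mulnn leq_mul2r p_gt2 orbT.
  have le3 : (3 * p ^ 2 <= p ^ 3)%N by rewrite [(p ^ 3)%N]expnS leq_mul2r p_gt2 orbT.
  have -> : ((p ^ 3 - p ^ 2 - p - 2) * p = p * p ^ 3 - p * p ^ 2 - p * p - 2 * p)%N.
    by rewrite !mulnBl ![(p ^ _ * p)%N]mulnC.
  have le4 : (3 * p ^ 3 <= p * p ^ 3)%N by rewrite leq_mul2r p_gt2 orbT.
  rewrite mulnn -expnS [(p ^ 3 * p)%N]mulnC; lia.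
rewrite rmorphB !rmorphM !rmorphXn /= zE xcE NypE -/x /r.
have nzxN : x ^+ N ^+ p != 0 by exact: expf_neq0 (expf_neq0 N nzx).
rewrite !mulrDr -!addrA; congr (_ + _); rewrite -[RHS]addr0.
congr (_ + _); apply/eqP; rewrite subr_eq0; apply/eqP.
rewrite [(x * _) ^+ N]exprMn [(_ / _) ^+ p]exprMn !exprMn exprVn.
set cN := mfrac (c^-1)%:MP ^+ N; set kp := mfrac kappa%:MP ^+ p; set hp := mfrac h ^+ p.
transitivity (cN * kp * hp * (x ^+ e * (x ^+ N * x ^+ E ^+ p) / x ^+ N ^+ p)).
  by rewrite !mulrA; congr (_ / _); ring.
by rewrite xexp (divff nzxN) mulr1.
Qed.

End InvariantRing.

(** * The generators *)

Lemma lead_mon_neq0 n (R : nzRingType) (g : {mpoly R[n]}) : lead_mon g != 0%MM -> g != 0.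
Proof. by apply: contraNneq => ->; rewrite /lead_mon msupp0 big_nil. Qed.

Lemma mulm1_neq0 n (i : 'I_n) k : (0 < k)%N -> (U_(i) *+ k)%MM != 0%MM.
Proof. by move=> k0; rewrite -mdeg_eq0 mdegMn mdeg1 mul1n -lt0n. Qed.

Section Generators.

Variables (p : nat) (F : fieldType) (M : 'M[F]_(2, 3)).
Hypothesis p_prime : prime p.
Hypothesis p_gt2 : (2 < p)%N.
Hypothesis charF : p \in [pchar F].
Hypothesis g123 : gammabar p M 1 2 3 = 0.
Hypothesis g124 : gammabar p M 1 2 4 != 0.
Hypothesis g135 : gammabar p M 1 3 5 != 0.
Variable h : {mpoly F[3]}.
Hypothesis hP : is_inv_h p M h.
Hypothesis inv_h : is_invariant p M h.
Let e := (p ^ 2 + p + 2)%N.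
Hypothesis lm_h : lead_mon h = (U_(ord3 1) *+ e)%MM.
Hypothesis lc_h : lead_cf h = 1.
Let f := inv_f p M.
Let Nz := orbit_prod p M (vz F).
Let B := [tuple vx F; f; h; Nz].
Let low (T : {mpoly F[4]}) := deg_le (ord4 2) p.-1 T.

Let p_odd : odd p.
Proof. by case: (even_prime p_prime) p_gt2 => [->|]. Qed.

Let p_gt0 : (0 < p)%N.
Proof. exact: prime_gt0. Qed.

Let p3_gt0 : (0 < p ^ 3)%N.
Proof. by rewrite expn_gt0 p_gt0. Qed.

Let B0 : tnth B (ord4 0) = vx F.
Proof. by []. Qed.

Let lmB1 : lead_mon (tnth B (ord4 1)) = (U_(ord3 1) *+ p)%MM.
Proof. exact: (lead_mon_f p_prime p_gt2 charF g124 g135).1. Qed.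

Let lmB2 : lead_mon (tnth B (ord4 2)) = (U_(ord3 1) *+ e)%MM.
Proof. exact: lm_h. Qed.

Let lmB3 : lead_mon (tnth B (ord4 3)) = (U_(ord3 2) *+ (p ^ 3))%MM.
Proof. exact: (lead_mon_orbit_prod_vz p_prime p_gt2 charF g135). Qed.

Let nzB i : tnth B i != 0.
Proof.
apply: lead_mon_neq0; case: i => [[|[|[|[|i]]]] Hi] //; rewrite (bool_irrelevance Hi isT).
- by rewrite B0 lead_monX mnm1_eq0.
- by rewrite lmB1 mulm1_neq0.
- by rewrite lmB2 mulm1_neq0 // /e addn2.
- by rewrite lmB3 mulm1_neq0.
Qed.

Let inv_B i : is_invariant p M (tnth B i).
Proof.
case: i => [[|[|[|[|i]]]] Hi] //; rewrite (tnth_nth 0) /=.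
- exact: invariant_vx.
- exact: invariant_f.
- exact: (invariant_orbit_prod p_prime charF (orbit_vz_inj p_prime p_gt2 charF g135)).
Qed.

(** A power of [x] times [x^(p^2 + 2 p) N_G(z) - a h^p] is low; low expressions can be divided by
    [x], and the result is solved for [h^p]. *)
Lemma monic_relation : exists2 W, low W & ('X_(ord4 2) ^+ p - W) \mPo B = 0.
Proof.
have [a nza locN] := loc_orbit_prod_vz p_prime p_gt2 charF g123 g124 g135 hP.
have [k [T [lowT eT]]] := loc_polynomial locN.
have [T' lowT' eT'] := comp_low_divxn p_odd B0 nzB lmB1 lmB2 lmB3 p3_gt0 lowT eT.
exists (a^-1 *: ('X_(ord4 0) ^+ (p ^ 2 + 2 * p) * 'X_(ord4 3) - T')).
  apply: deg_leZ; apply: deg_leB => //; apply: (@deg_leW _ _ _ (0 + 0)%N) => //.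
  by apply: deg_leM; [apply: deg_le_xn | apply: deg_leX; rewrite mnm1E].
rewrite rmorphB /= comp_mpolyZ rmorphB rmorphM /= -eT' !rmorphXn /= !comp_mpolyXU /=.
rewrite subKr mul_mpolyC scalerA mulVf // scale1r; exact: subrr.
Qed.

(** A power of [x] times [g] is an expression in [B]; the monic relation makes this expression low,
    and then the power of [x] can be divided out. *)
Lemma invariant_comp_low g : is_invariant p M g -> exists2 T, low T & g = T \mPo B.
Proof.
move=> /(loc_invariant p_prime p_gt2 charF g123 g124 g135 hP)[d /loc_polynomial].
case=> k [P [_ eP]]; have [W lowW WB] := monic_relation.
have [T lowT PT] := comp_low_of_relation p_odd P lowW WB.
rewrite PT in eP; exact: (comp_low_divxn p_odd B0 nzB lmB1 lmB2 lmB3 p3_gt0 lowT eP).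
Qed.

Lemma invariant_lead_mon g : is_invariant p M g -> g != 0 ->
  exists I, lead_mon g = lead_mon ('X_[I] \mPo B).
Proof.
move=> /invariant_comp_low[T lowT ->] nz.
have nzT : T != 0 by apply: contraNneq nz => ->; rewrite comp_mpoly0.
have [_ [I _ lm]] := lead_mon_comp_low p_odd B0 nzB lmB1 lmB2 lmB3 p3_gt0 lowT nzT.
by exists I.
Qed.

Lemma sagbi_basis_invariants : sagbi_basis (is_invariant p M) (fun b => b \in B).
Proof.
apply: sagbi_basis_of_lead_mon; first exact: nzB.
- exact: invariant1.
- exact: invariantM.
- exact: inv_B.
- exact: invariant_lead_mon.
Qed.

Lemma subducts_invariant g : is_invariant p M g -> exists Q, subducts B g Q.
Proof.
apply: subducts_exists => // [{}g c I inv_g|]; last exact: invariant_lead_mon.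
apply: invariantB => //; apply: invariantZ; rewrite comp_mpolyX.
elim/big_ind: _ => [|u v|i _]; first exact: invariant1.
  exact: invariantM.
exact/invariantXn/inv_B.
Qed.

(** Both powers have lead term [y^(p e)] with coefficient [1], so the difference starts strictly
    below it. *)
Lemma relation_low Q : subducts B (f ^+ e - h ^+ p) Q -> low Q.
Proof.
move=> sQ; apply: (subducts_low p_odd B0 nzB lmB1 lmB2 lmB3 p3_gt0 sQ).
(* For a zero difference [lead_mon] takes its default value, the unit monomial. *)
have [g0|nz] := eqVneq (f ^+ e - h ^+ p) 0.
  rewrite g0 {1}/lead_mon msupp0 big_nil; apply/grevlex_0lt/mulm1_neq0.
  by rewrite muln_gt0 p_gt0 addn2.
have nzf : f != 0 := nzB (ord4 1).
have nzh : h != 0 := nzB (ord4 2).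
have mulmM (i : 'I_3) a b : (U_(i) *+ (a * b) = U_(i) *+ a *+ b)%MM.
  by apply/mnmP => j; rewrite !mulmnE mulnA.
have lmf : lead_mon (f ^+ e) = (U_(ord3 1) *+ (p * e))%MM.
  by rewrite lead_monXn // [lead_mon f]lmB1 mulmM.
rewrite -/e -lmf; apply: lead_mon_sub_lt nz.
  by rewrite lmf lead_monXn // lm_h -mulmM mulnC.
rewrite !lead_cfXn lc_h [lead_cf f](lead_mon_f p_prime p_gt2 charF g124 g135).2.
by rewrite !expr1n.
Qed.

(** As [Q] is low, the relation is, up to sign, monic of degree [p] in the third variable, so
    [kernel_of_relation] applies. *)
Lemma relation_kernel Q P : subducts B (f ^+ e - h ^+ p) Q ->
  P \mPo B = 0 <-> exists S, P = S * ('X_(ord4 1) ^+ e - 'X_(ord4 2) ^+ p - Q).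
Proof.
move=> sQ; have lowQ := relation_low sQ.
have lowW : low ('X_(ord4 1) ^+ e - Q).
  apply: deg_leB => //; apply: (@deg_leW _ _ _ (0 * e)%N) => //.
  by apply/deg_leXn/deg_leX; rewrite mnm1E.
have WB : ('X_(ord4 2) ^+ p - ('X_(ord4 1) ^+ e - Q)) \mPo B = 0.
  rewrite !rmorphB !rmorphXn /= !comp_mpolyXU /= -(subductsE sQ).
  by rewrite subKr subrr.
have -> := kernel_of_relation p_odd B0 nzB lmB1 lmB2 lmB3 p3_gt0 P lowW WB.
by split=> -[S ->]; exists (- S); ring.
Qed.

Lemma invariant_relation : is_invariant p M (f ^+ e - h ^+ p).
Proof.
by apply: invariantB; apply: invariantXn; rewrite //; apply: invariant_f.
Qed.

End Generators.

Theorem theorem8p9 (p : nat) (F : fieldType) (M : 'M[F]_(2, 3))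
    (p_prime : prime p) (p_gt2 : (2 < p)%N) (charF : p \in [pchar F])
    (g123 : gammabar p M 1 2 3 = 0)
    (g124 : gammabar p M 1 2 4 != 0)
    (g135 : gammabar p M 1 3 5 != 0) :
  exists2 h : {mpoly F[3]}, is_inv_h p M h &
    let f := inv_f p M in
    let B : 4.-tuple {mpoly F[3]} := [tuple vx F; f; h; orbit_prod p M (vz F)] in
    let tf : {mpoly F[4]} := 'X_(@Ordinal 4 1 isT) in
    let th : {mpoly F[4]} := 'X_(@Ordinal 4 2 isT) in
    let e := (p ^ 2 + p + 2)%N in
    [/\ sagbi_basis (is_invariant p M) (fun b => b \in B),
        exists Q, subducts B (f ^+ e - h ^+ p) Q
      & forall Q, subducts B (f ^+ e - h ^+ p) Q ->
          forall P : {mpoly F[4]},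
            P \mPo B = 0 <-> exists S, P = S * (tf ^+ e - th ^+ p - Q)].
Proof.
have [h [hP inv_h lm_h lc_h]] := inv_h_exists p_prime p_gt2 charF g123 g124 g135.
exists h => //; split.
- exact: sagbi_basis_invariants.
- by apply: subducts_invariant => //; apply: invariant_relation.
- by move=> Q sQ P; apply: relation_kernel.
Qed.
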